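(* Let $S$ be a polynomial ring in finitely many variables over a field, and let $I$ and $J$ be two arbitrary monomial complete intersections in $S$. Let $f_1,\dots,f_r$ be the monomial generators of $I$, and let $Q_1,\dots,Q_r$ be arbitrary monomial ideals of $S$ (not necessarily proper). Then $$\operatorname{reg}\big(f_1(J:Q_1) + \cdots + f_r(J:Q_r)\big) \le \operatorname{reg}(I) + \operatorname{reg}(J).$$
   Context: $S$ carries the standard grading (every variable has degree $1$). For a homogeneous ideal $I$ of $S$ with minimal graded free resolution $0 \to \bigoplus_j S(-b_{mj}) \to \cdots \to \bigoplus_j S(-b_{0j}) \to I \to 0$, the Castelnuovo-Mumford regularity of $I$ is $\operatorname{reg}(I) := \max_{i,j}\{b_{ij}-i \mid i=0,\dots,m\}$ (so that the unit ideal has $\operatorname{reg}(S)=0$). The monomial generators of a monomial ideal are the monomials forming its unique minimal monomial generating set. A monomial complete intersection is a nonzero monomial ideal that is a complete intersection, i.e. its monomial generators form a regular sequence (equivalently, they are pairwise coprime). $J:Q = \{s\in S \mid sQ \subseteq J\}$ denotes the ideal quotient. *)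

(* Defs.v *)
From Stdlib Require Import ClassicalEpsilon.
From HB Require Import structures.
From mathcomp Require Import all_boot all_order all_algebra.
From mathcomp Require Import mpoly.

Set Implicit Arguments.
Unset Strict Implicit.
Unset Printing Implicit Defensive.

Import Order.TTheory GRing.Theory Num.Theory.
Local Open Scope ring_scope.

(* Subsets and ideals of S = k[x_1, ..., x_n] are Prop-valued predicates: the
   colon ideals below quantify over arbitrary ideals, and MathComp's [idealr]
   interface is boolean and only covers proper ideals. *)

Section Ideals.

Variables (k : fieldType) (n : nat).
Local Notation S := {mpoly k[n]}.
Implicit Types (I J Q : S -> Prop) (A : S -> Prop).

Definition ideal_span A (p : S) : Prop :=
  exists (l : nat) (a g : 'I_l -> S),
    (forall i, A (g i)) /\ p = \sum_(i < l) a i * g i.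

Definition monomial_span (M : 'X_{1..n} -> Prop) : S -> Prop :=
  ideal_span (fun p => exists2 m, M m & p = 'X_[m]).

Definition monomial_ideal I : Prop :=
  exists M : 'X_{1..n} -> Prop, forall p, I p <-> monomial_span M p.

Definition monomials_generate (f : seq 'X_{1..n}) I : Prop :=
  forall p, I p <-> monomial_span (fun m => m \in f) p.

Definition monomial_generators (f : seq 'X_{1..n}) I : Prop :=
  [/\ uniq f, monomials_generate f I
    & forall g : seq 'X_{1..n},
        {subset g <= f} -> monomials_generate g I -> {subset f <= g}].

(* Each term is a nonzerodivisor modulo the preceding ones. Properness of the
   ideal generated by [s] is not required; for minimal systems of monomial
   generators the condition is then exactly pairwise coprimality, and the unit
   ideal, generated by the monomial 1, is allowed. *)
Definition regular_sequence (s : seq S) : Prop :=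
  forall i, (i < size s)%N -> forall p,
    ideal_span (fun q => q \in take i s) (p * s`_i) ->
    ideal_span (fun q => q \in take i s) p.

Definition monomial_complete_intersection I : Prop :=
  [/\ monomial_ideal I, exists2 p, I p & p != 0
    & exists2 f, monomial_generators f I
               & regular_sequence [seq 'X_[m] | m <- f]].

Definition colon J Q (s : S) : Prop := forall q, Q q -> J (s * q).

Definition ideal_scale (f : S) I (p : S) : Prop :=
  exists2 s, I s & p = f * s.

Definition ideal_sum (r : nat) (I : 'I_r -> S -> Prop) (p : S) : Prop :=
  exists2 a : 'I_r -> S, forall i, I i (a i) & p = \sum_(i < r) a i.

(* Homogeneous of degree [e], with S graded by the integers: 0 is the only
   element of negative degree, and it belongs to every graded piece. *)
Definition homog_deg (p : S) (e : int) : Prop :=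
  match e with
  | Posz d => p \is d.-homog
  | Negz _ => p = 0
  end.

(* The data of a complex ... -> F_1 -> F_0 -> S of finitely generated graded
   free modules F_i = \bigoplus_(j < rank i) S(- shift i j). Elements of F_i are
   row vectors, and the maps act by multiplication on the right. *)
Record free_complex := FreeComplex {
  rank : nat -> nat;
  shift : forall i, 'I_(rank i) -> int;
  aug : 'cV[S]_(rank 0);
  diff : forall i, 'M[S]_(rank i.+1, rank i)
}.

Definition graded (F : free_complex) : Prop :=
  (forall j, homog_deg (aug F j 0) (shift j)) /\
  (forall i (j : 'I_(rank F i.+1)) (l : 'I_(rank F i)),
     homog_deg (diff F i j l) (shift j - shift l)).

Definition finite_length (F : free_complex) : Prop :=
  exists m, forall i, (m < i)%N -> rank F i = 0%N.

Definition resolves (F : free_complex) I : Prop :=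
  [/\ forall p, I p <-> exists v : 'rV_(rank F 0), p = (v *m aug F) 0 0,
      forall v : 'rV_(rank F 0),
        v *m aug F = 0 <-> exists w, v = w *m diff F 0
    & forall i (v : 'rV_(rank F i.+1)),
        v *m diff F i = 0 <-> exists w, v = w *m diff F i.+1].

(* The image of F_(i+1) lies in (x_1, ..., x_n) F_i. *)
Definition minimal (F : free_complex) : Prop :=
  forall i j l, (diff F i j l)@_(0%MM) = 0.

Definition minimal_graded_free_resolution (F : free_complex) I : Prop :=
  [/\ graded F, finite_length F, resolves F I & minimal F].

Definition is_regularity I (d : int) : Prop :=
  exists F, [/\ minimal_graded_free_resolution F I,
    exists i (j : 'I_(rank F i)), d = shift j - i%:Z
    & forall i (j : 'I_(rank F i)), shift j - i%:Z <= d].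

(* Meaningful for nonzero homogeneous ideals: for these a minimal graded free
   resolution exists and is unique up to isomorphism. *)
Definition reg I : int := epsilon (inhabits 0) (is_regularity I).

End Ideals.

(* Main.v *)
(* Sums: a short exact sequence 0 -> A \cap B -> A (+) B -> A + B -> 0 bounds
   reg(A + B) by max(reg A, reg B, reg(A \cap B) - 1).  Since the f_i are
   coprime, f_r(J : Q_r) meets f_1(J : Q_1) + ... + f_(r-1)(J : Q_(r-1)) in
   f_r (\sum_(i < r) f_i (J : (f_r Q_i + f_i Q_r))), an ideal of the same shape,
   and induction on r reduces the theorem to reg(J : Q) <= reg J.

   Colon ideals: cutting J : Q into slices by the exponent of one variable after
   the other gives reg(J : Q) <= 1 + \sum_l (deg g_l - 1), where the g_l generate
   J.

   A resolution gives a minimal one by discarding redundant generators stage by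
   stage, and each shift of a minimal resolution occurs in every resolution.
   The Koszul complex therefore shows that reg I is at least, hence equal to,
   1 + \sum_i (deg f_i - 1), and likewise for J. *)

Require Import Defs.
From Stdlib Require Import ClassicalEpsilon.
From mathcomp Require Import all_boot all_order all_algebra.
From mathcomp Require Import mpoly lra zify.

Set Implicit Arguments.
Unset Strict Implicit.
Unset Printing Implicit Defensive.

Import Order.TTheory GRing.Theory Num.Theory.
Local Open Scope ring_scope.

(** * Graded matrices and submodules *)

Section Graded.

Variables (k : fieldType) (n : nat).
Local Notation S := {mpoly k[n]}.
Implicit Types (p q : S) (d e : int).

(** Exact sequences do not preserve minimality, so every upper bound is proved for some graded
    resolution whose shifts at stage i are at most d + i; minimality enters only when such a bound
    is compared with [reg]. As [reg] is obtained by choice, a minimal resolution of finite length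
    must be produced before anything can be said about it.

    Colon ideals of J are in general not complete intersections and have no uniform explicit
    resolution. What controls them is that each variable x_v occurs in at most one generator g of J:
    only the exponents 0, ..., g(v) of x_v matter, and the degree t spent on fixing such an exponent
    is paid for by the degree lost in the remaining part of g. The resulting bound is uniform in Q,
    and it has to be, because the induction over the generators of I replaces Q_i by f_r Q_i + f_i
    Q_r.

    The unit ideal is a separate case on either side: its generator has degree 0 and contributes -1,
    which natural number subtraction would truncate to 0. *)

Lemma homog_degP p e :
  homog_deg p e <-> forall m, p@_m != 0 -> (mdeg m)%:Z = e.
Proof.
case: e => d /=; split.
- by move=> /dhomogP hp m; rewrite -mcoeff_msupp => /hp ->.
- by move=> hp; apply/dhomogP => m; rewrite mcoeff_msupp => /hp [].
- by move=> -> m; rewrite mcoeff0 eqxx.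
- by move=> hp; apply/mpolyP => m; rewrite mcoeff0; apply/eqP/negPn/negP => /hp.
Qed.

Lemma homog_degD p q e : homog_deg p e -> homog_deg q e -> homog_deg (p + q) e.
Proof.
move=> /homog_degP hp /homog_degP hq; apply/homog_degP => m; rewrite mcoeffD.
have [p0|/hp //] := eqVneq p@_m 0; have [q0|/hq //] := eqVneq q@_m 0.
by rewrite p0 q0 addr0 eqxx.
Qed.

Lemma homog_deg0 e : homog_deg (0 : S) e.
Proof. by apply/homog_degP => m; rewrite mcoeff0 eqxx. Qed.

Lemma homog_degN p e : homog_deg p e -> homog_deg (- p) e.
Proof.
by move=> /homog_degP hp; apply/homog_degP => m; rewrite mcoeffN oppr_eq0 => /hp.
Qed.

Lemma homog_degM p q d e :
  homog_deg p d -> homog_deg q e -> homog_deg (p * q) (d + e).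
Proof.
move=> /homog_degP hp /homog_degP hq; apply/homog_degP => m.
rewrite -mcoeff_msupp => /msuppM_le /allpairsP [[a b] /= [pa qb ->]].
by rewrite !mcoeff_msupp in pa qb; rewrite mdegD PoszD (hp _ pa) (hq _ qb).
Qed.

Lemma homog_deg_sum (I : finType) (F : I -> S) e :
  (forall i, homog_deg (F i) e) -> homog_deg (\sum_i F i) e.
Proof.
move=> hF; apply: (big_ind (fun p => homog_deg p e)) => //.
  exact: homog_deg0.
by move=> p q; exact: homog_degD.
Qed.

Lemma homog_degX (m : 'X_{1..n}) : homog_deg ('X_[m] : S) (mdeg m)%:Z.
Proof. by rewrite /= dhomogX. Qed.

Lemma homog_deg1 : homog_deg (1 : S) 0.
Proof. exact: dhomog1. Qed.

Lemma homog_deg_id (r : nat) (s : 'I_r -> int) (i j : 'I_r) :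
  homog_deg ((1%:M : 'M[S]_r) i j) (s i - s j).
Proof.
rewrite mxE; case: eqP => [->|_]; last exact: homog_deg0.
by rewrite subrr; exact: homog_deg1.
Qed.

Definition mrestrict (P : pred 'X_{1..n}) p : S :=
  \sum_(m <- msupp p | P m) p@_m *: 'X_[m].

Lemma mcoeff_mrestrict P p m :
  (mrestrict P p)@_m = if P m then p@_m else 0.
Proof.
rewrite /mrestrict raddf_sum /=.
under eq_bigr do rewrite mcoeffZ mcoeffX.
have [mp|mNp] := boolP (m \in msupp p); last first.
  rewrite (memN_msupp_eq0 mNp) if_same big_seq_cond big1 // => m' /andP [m'p _].
  by case: eqP => [m'E|]; [rewrite -m'E m'p in mNp | rewrite mulr0].
rewrite big_mkcond (bigD1_seq m) ?msupp_uniq //= eqxx mulr1 big1 ?addr0 //.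
by move=> m' /negPf ->; rewrite mulr0 if_same.
Qed.

Definition hcomp e p : S := mrestrict (fun m => (mdeg m)%:Z == e) p.

Lemma mcoeff_hcomp e p m :
  (hcomp e p)@_m = if (mdeg m)%:Z == e then p@_m else 0.
Proof. exact: mcoeff_mrestrict. Qed.

Lemma hcomp_homog e p : homog_deg (hcomp e p) e.
Proof.
by apply/homog_degP => m; rewrite mcoeff_hcomp; case: ((mdeg m)%:Z =P e); rewrite ?eqxx.
Qed.

Lemma hcomp_id e p : homog_deg p e -> hcomp e p = p.
Proof.
move=> /homog_degP hp; apply/mpolyP => m; rewrite mcoeff_hcomp.
by case: eqP => // me; have [//|/hp /me] := eqVneq p@_m 0.
Qed.

Lemma hcompD e : {morph hcomp e : p q / p + q}.
Proof.
move=> p q; apply/mpolyP => m; rewrite mcoeffD !mcoeff_hcomp mcoeffD.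
by case: ifP => // _; rewrite addr0.
Qed.

Lemma hcomp0 e : hcomp e 0 = 0.
Proof. by apply/mpolyP => m; rewrite mcoeff_hcomp mcoeff0 if_same. Qed.

Lemma hcompM d e p q : homog_deg q e -> hcomp (d + e) (p * q) = hcomp d p * q.
Proof.
move=> hq; rewrite -(subrK (hcomp d p * q) (p * q)) hcompD.
rewrite (hcomp_id (homog_degM (hcomp_homog d p) hq)) -mulrBl.
suff -> : hcomp (d + e) ((p - hcomp d p) * q) = 0 by rewrite add0r.
apply/mpolyP => m; rewrite mcoeff_hcomp mcoeff0; case: eqP => // md.
apply/memN_msupp_eq0/negP => /msuppM_le /allpairsP [[a b] /= [pa qb mE]].
move: pa; rewrite mcoeff_msupp mcoeffB mcoeff_hcomp.
suff -> : (mdeg a)%:Z = d by rewrite eqxx subrr eqxx.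
move: md; rewrite mE mdegD PoszD.
have -> : (mdeg b)%:Z = e by move/homog_degP: hq; apply; rewrite -mcoeff_msupp.
by move/(@addIr _ e).
Qed.

Lemma homog_deg_cst p : homog_deg p 0 -> p = (p@_0)%:MP.
Proof.
move=> /homog_degP hp; apply/mpolyP => m; rewrite mcoeffC.
have [->|m0] := eqVneq m 0%MM; first by rewrite mulr1.
rewrite mulr0; apply/eqP/negPn/negP => /hp [] /eqP.
by rewrite mdeg_eq0 (negPf m0).
Qed.

Lemma homog_deg_mcoeff0 p e : homog_deg p e -> p@_0 != 0 -> e = 0.
Proof. by move=> /homog_degP hp /hp; rewrite mdeg0. Qed.

Lemma mcoeff0M p q : (p * q)@_0 = p@_0 * q@_0.
Proof. exact: (rmorphM (mcoeff 0%MM : {rmorphism S -> k})). Qed.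

Definition graded_mx (r s : nat) (a : 'I_r -> int) (b : 'I_s -> int)
    (A : 'M[S]_(r, s)) : Prop :=
  forall i j, homog_deg (A i j) (a i - b j).

Lemma graded_mxM r s t a b c (A : 'M_(r, s)) (B : 'M_(s, t)) :
  graded_mx a b A -> graded_mx b c B -> graded_mx a c (A *m B).
Proof.
move=> hA hB i j; rewrite mxE; apply: homog_deg_sum => l.
by rewrite -(subrKA (b l)); apply: homog_degM.
Qed.

Lemma graded_mx1 r (a : 'I_r -> int) : graded_mx a a 1%:M.
Proof. by move=> i j; exact: homog_deg_id. Qed.

Lemma graded_mx0 r s (a : 'I_r -> int) (b : 'I_s -> int) : graded_mx a b 0.
Proof. by move=> i j; rewrite mxE; exact: homog_deg0. Qed.

Lemma graded_mxN r s (a : 'I_r -> int) (b : 'I_s -> int) A :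
  graded_mx a b A -> graded_mx a b (- A).
Proof. by move=> hA i j; rewrite mxE; exact: homog_degN. Qed.

Definition cat_shift (r s : nat) (a : 'I_r -> int) (b : 'I_s -> int)
    (i : 'I_(r + s)) : int :=
  match split i with inl j => a j | inr j => b j end.

Lemma cat_shiftl r s (a : 'I_r -> int) (b : 'I_s -> int) i :
  cat_shift a b (lshift s i) = a i.
Proof. by rewrite /cat_shift (unsplitK (inl i)). Qed.

Lemma cat_shiftr r s (a : 'I_r -> int) (b : 'I_s -> int) i :
  cat_shift a b (rshift r i) = b i.
Proof. by rewrite /cat_shift (unsplitK (inr i)). Qed.

Lemma cat_shiftP r s (a : 'I_r -> int) (b : 'I_s -> int) (P : int -> Prop) :
  (forall i, P (a i)) -> (forall i, P (b i)) -> forall i, P (cat_shift a b i).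
Proof.
by move=> ha hb i; case: (split_ordP i) => j ->; rewrite ?cat_shiftl ?cat_shiftr.
Qed.

Lemma graded_col_mx r s t (a : 'I_r -> int) (b : 'I_s -> int) (c : 'I_t -> int)
    A B :
  graded_mx a c A -> graded_mx b c B ->
  graded_mx (cat_shift a b) c (col_mx A B).
Proof.
move=> hA hB i j; case: (split_ordP i) => l ->.
  by rewrite col_mxEu cat_shiftl.
by rewrite col_mxEd cat_shiftr.
Qed.

Lemma graded_row_mx r s t (a : 'I_r -> int) (b : 'I_s -> int) (c : 'I_t -> int)
    A B :
  graded_mx c a A -> graded_mx c b B ->
  graded_mx c (cat_shift a b) (row_mx A B).
Proof.
move=> hA hB i j; case: (split_ordP j) => l ->.
  by rewrite row_mxEl cat_shiftl.
by rewrite row_mxEr cat_shiftr.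
Qed.

(** The degree [e] part of an element of the free module with shifts [a]: basis vector [j] has
    degree [a j], so entry [j] is cut in degree [e - a j]. *)
Definition hcompv (r : nat) (a : 'I_r -> int) e (v : 'rV[S]_r) : 'rV[S]_r :=
  \row_j hcomp (e - a j) (v 0 j).

Lemma hcompv_mul r s a b (A : 'M_(r, s)) e v :
  graded_mx a b A -> hcompv b e (v *m A) = hcompv a e v *m A.
Proof.
move=> hA; apply/rowP => j; rewrite !mxE.
rewrite (big_morph _ (hcompD _) (hcomp0 _)); apply: eq_bigr => i _.
by rewrite !mxE -(subrKA (a i)) hcompM.
Qed.

Lemma hcompv_homog r (a : 'I_r -> int) e (v : 'rV_r) j :
  homog_deg (hcompv a e v 0 j) (e - a j).
Proof. by rewrite mxE; exact: hcomp_homog. Qed.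

Lemma hcompv_id r (a : 'I_r -> int) e (v : 'rV_r) :
  (forall j, homog_deg (v 0 j) (e - a j)) -> hcompv a e v = v.
Proof. by move=> hv; apply/rowP => j; rewrite mxE hcomp_id. Qed.

Lemma hcompv_row r s a b (A : 'M_(r, s)) i :
  graded_mx a b A -> hcompv b (a i) (row i A) = row i A.
Proof. by move=> hA; apply: hcompv_id => j; rewrite mxE. Qed.

Definition graded_submodule (r : nat) (a : 'I_r -> int)
    (K : 'rV[S]_r -> Prop) : Prop :=
  [/\ K 0, forall u v, K u -> K v -> K (u + v),
      forall p v, K v -> K (p *: v)
    & forall e v, K v -> K (hcompv a e v)].

Lemma graded_submoduleMx r a (K : 'rV[S]_r -> Prop) s (B : 'M_(s, r)) w :
  graded_submodule a K -> (forall i, K (row i B)) -> K (w *m B).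
Proof.
move=> [K0 KD KZ _] KB; rewrite mulmx_sum_row.
by apply: (big_ind K) => // i _; exact: KZ.
Qed.

Lemma graded_submoduleB r a (K : 'rV[S]_r -> Prop) u v :
  graded_submodule a K -> K u -> K v -> K (u - v).
Proof. by move=> [_ KD KZ _] Ku Kv; rewrite -scaleN1r; apply/KD/KZ. Qed.

Lemma graded_preim r s a b (A : 'M_(r, s)) (K : 'rV[S]_s -> Prop) :
  graded_mx a b A -> graded_submodule b K ->
  graded_submodule a (fun v => K (v *m A)).
Proof.
move=> hA [K0 KD KZ Kc]; split=> [|u v Ku Kv|p v Kv|e v Kv].
- by rewrite mul0mx.
- by rewrite mulmxDl; apply: KD.
- by rewrite -scalemxAl; apply: KZ.
- by rewrite -(hcompv_mul _ _ hA); apply: Kc.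
Qed.

Lemma graded_zero r (b : 'I_r -> int) : graded_submodule b (fun v => v = 0).
Proof.
split=> [|u v -> ->|p v ->|e v ->] //; first by rewrite addr0.
  by rewrite scaler0.
by apply/rowP => j; rewrite !mxE hcomp0.
Qed.

Lemma graded_full r (a : 'I_r -> int) :
  graded_submodule a (fun _ => True).
Proof. by split. Qed.

Lemma graded_ker r s a b (A : 'M_(r, s)) :
  graded_mx a b A -> graded_submodule a (fun v => v *m A = 0).
Proof. by move=> hA; exact: graded_preim hA (graded_zero b). Qed.

(** Arbitrary preimages of the rows can be made homogeneous: projecting to degree [a i] commutes
    with [B], stays in [K] and fixes row [i] of [C]. *)
Lemma graded_lift r s t a b c (K : 'rV[S]_s -> Prop)
    (B : 'M_(s, t)) :
  graded_submodule b K -> graded_mx b c B ->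
  forall C : 'M_(r, t), graded_mx a c C ->
  (forall i, exists2 v, K v & row i C = v *m B) ->
  exists A : 'M[S]_(r, s), [/\ graded_mx a b A, C = A *m B & forall i, K (row i A)].
Proof.
move=> [_ _ _ Kc] hB C hC hK.
have /fin_all_exists [F hF] i : exists v,
    [/\ K v, row i C = v *m B & forall j, homog_deg (v 0 j) (a i - b j)].
  have [v Kv vE] := hK i; exists (hcompv b (a i) v); split; first exact: Kc.
    by rewrite -(hcompv_mul _ _ hB) -vE (hcompv_row _ hC).
  by move=> j; exact: hcompv_homog.
exists (\matrix_i F i); split.
- by move=> i j; rewrite mxE; have [_ _] := hF i.
- by apply/row_matrixP => i; rewrite row_mul rowK; have [_ ->] := hF i.
- by move=> i; rewrite rowK; have [] := hF i.
Qed.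

End Graded.

(** * Bounded graded resolutions *)

Section Resolutions.

Variables (k : fieldType) (n : nat).
Local Notation S := {mpoly k[n]}.

(* A graded free resolution of length l whose shifts at stage i are at most
   d + i; [K] is a submodule of a free module with shifts [a]. *)
Fixpoint resolved (l : nat) (d : int) (r : nat) (a : 'I_r -> int)
    (K : 'rV[S]_r -> Prop) : Prop :=
  if l is l'.+1 then
    exists s (b : 'I_s -> int) (A : 'M[S]_(s, r)),
      [/\ graded_mx b a A, forall i, b i <= d,
          forall v, K v <-> exists w, v = w *m A
        & resolved l' (d + 1) b (fun w => w *m A = 0)]
  else forall v, K v <-> v = 0.

Lemma eq_resolved l d r (a : 'I_r -> int) K K' :
  (forall v, K v <-> K' v) -> resolved l d a K -> resolved l d a K'.
Proof.
case: l => [|l] /= eqK; first by move=> h v; rewrite -eqK.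
move=> [s [b [A [hA hb hK hl]]]]; exists s, b, A; split=> // v.
by rewrite -eqK.
Qed.

Lemma resolved_le l d e r (a : 'I_r -> int) K :
  d <= e -> resolved l d a K -> resolved l e a K.
Proof.
elim: l d e r a K => //= l IHl d e r a K de [s [b [A [hA hb hK hl]]]].
exists s, b, A; split=> // [i|]; first exact: le_trans (hb i) de.
by apply: IHl hl; rewrite lerD2r.
Qed.

Lemma resolvedS l d r (a : 'I_r -> int) K :
  resolved l d a K -> resolved l.+1 d a K.
Proof.
elim: l d r a K => [|l IHl] d r a K.
  move=> /= hK; exists 0%N, (fun _ => 0), 0; split=> [[] //|[] //|v|v].
    by rewrite hK; split=> [->|[w ->]]; [exists 0 | ]; rewrite mulmx0.
  by rewrite [v]thinmx0 mul0mx.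
move=> [s [b [A [hA hb hK hl]]]]; exists s, b, A; split=> //.
exact: IHl.
Qed.

Lemma resolved_leq l l' d r (a : 'I_r -> int) K :
  (l <= l')%N -> resolved l d a K -> resolved l' d a K.
Proof.
move=> /subnKC <-; elim: (l' - l)%N => [|m IHm] hl; first by rewrite addn0.
by rewrite addnS; apply/resolvedS/IHm.
Qed.

(** Only the last map changes, from [B] to [B *m A]. Injectivity of [A] on [K] keeps its kernel, so
    the rest of the resolution is reused. *)
Lemma resolved_inj l d r s (a : 'I_r -> int) (b : 'I_s -> int) K
    (A : 'M_(r, s)) :
  graded_mx a b A -> (forall v, K v -> v *m A = 0 -> v = 0) ->
  graded_submodule a K ->
  resolved l d a K -> resolved l d b (fun v => exists2 u, K u & v = u *m A).
Proof.
case: l => [|l] hA injA sK /=.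
  move=> hK v; split=> [[u /hK -> ->]|->]; first by rewrite mul0mx.
  by exists 0; [apply/hK | rewrite mul0mx].
move=> [t [c [B [hB hc hK hl]]]]; exists t, c, (B *m A); split=> //.
- exact: graded_mxM hB hA.
- move=> v; split=> [[u /hK [w ->] ->]|[w ->]].
    by exists w; rewrite mulmxA.
  by exists (w *m B); [apply/hK; exists w | rewrite mulmxA].
- apply: eq_resolved hl => w; rewrite mulmxA; split=> [->|]; first by rewrite mul0mx.
  by apply: injA; apply/hK; exists w.
Qed.

Lemma resolved_shift l d e r (a : 'I_r -> int) K :
  resolved l d a K -> resolved l (d + e) (fun i => a i + e) K.
Proof.
elim: l d r a K => //= l IHl d r a K [s [b [A [hA hb hK hl]]]].
exists s, (fun i => b i + e), A; split=> // [i j|i|].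
- by rewrite opprD addrACA subrr addr0.
- by rewrite lerD2r.
- by rewrite addrAC; exact: IHl.
Qed.

Lemma resolved_free d r (a : 'I_r -> int) :
  (forall i, a i <= d) -> resolved 1 d a (fun _ => True).
Proof.
move=> ha; exists r, a, 1%:M; split=> // [|v|v].
- exact: graded_mx1.
- by split=> // _; exists v; rewrite mulmx1.
- by rewrite mulmx1.
Qed.

(* The horseshoe lemma for 0 -> K1 -> K -> K2 -> 0. *)
Lemma resolved_extension l d r (a : 'I_r -> int) (K1 K : 'rV[S]_r -> Prop)
    s (b : 'I_s -> int) (K2 : 'rV[S]_s -> Prop) (A : 'M_(r, s)) :
  graded_mx a b A -> graded_submodule a K ->
  (forall v, K v -> K2 (v *m A)) ->
  (forall w, K2 w -> exists2 v, K v & w = v *m A) ->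
  (forall v, K1 v <-> K v /\ v *m A = 0) ->
  resolved l d a K1 -> resolved l d b K2 -> resolved l d a K.
Proof.
elim: l d r a K1 K s b K2 A => [|l IHl] d r a K1 K s b K2 A hA sK KA surj hK1.
  move=> /= hK10 hK20 v; split=> [Kv|->]; last by case: sK.
  by apply/hK10/hK1; split=> //; apply/hK20/KA.
move=> [r1 [c1 [B1 [hB1 hc1 span1 res1]]]] [r2 [c2 [B2 [hB2 hc2 span2 res2]]]].
have K1row i : K1 (row i B1) by apply/span1; exists (delta_mx 0 i); rewrite rowE.
have K2row i : K2 (row i B2) by apply/span2; exists (delta_mx 0 i); rewrite rowE.
have [L [hL B2E KL]] := graded_lift sK hA hB2 (fun i => surj _ (K2row i)).
have KB1 i : K (row i B1) by have /hK1 [] := K1row i.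
have B1A : B1 *m A = 0.
  by apply/row_matrixP => i; rewrite row_mul row0; have /hK1 [] := K1row i.
exists (r1 + r2)%N, (cat_shift c1 c2), (col_mx B1 L); split.
- exact: graded_col_mx.
- exact: (@cat_shiftP _ _ _ _ (fun x => x <= d)).
- move=> v; split=> [Kv|[w ->]]; last first.
    rewrite -[w]hsubmxK mul_row_col; case: (sK) => _ KD _ _.
    by apply: KD; apply: graded_submoduleMx sK _.
  have /span2 [w2 w2E] := KA _ Kv.
  have /span1 [w1 w1E] : K1 (v - w2 *m L).
    apply/hK1; split; last by rewrite mulmxBl -mulmxA -B2E w2E subrr.
    exact: graded_submoduleB sK Kv (graded_submoduleMx _ sK KL).
  by exists (row_mx w1 w2); rewrite mul_row_col -w1E subrK.
(* The syzygies of [col_mx B1 L] again form an extension: [iota] embeds those of [B1] and [pi] maps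
   onto those of [B2], so the induction hypothesis applies to them. *)
pose iota : 'M[S]_(r1, r1 + r2) := row_mx 1%:M 0.
pose pi : 'M[S]_(r1 + r2, r2) := col_mx 0 1%:M.
have hiota : graded_mx c1 (cat_shift c1 c2) iota.
  by apply: graded_row_mx; [exact: graded_mx1 | exact: graded_mx0].
have hpi : graded_mx (cat_shift c1 c2) c2 pi.
  by apply: graded_col_mx; [exact: graded_mx0 | exact: graded_mx1].
have hcol := graded_col_mx hB1 hL.
have iotaE w : w *m iota = row_mx w 0 by rewrite mul_mx_row mulmx1 mulmx0.
have piE (v : 'rV_(r1 + r2)) : v *m pi = rsubmx v.
  by rewrite -{1}[v]hsubmxK mul_row_col mulmx0 mulmx1 add0r.
have {}res1 := resolved_inj hiota _ (graded_ker hB1) res1.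
apply: (IHl _ _ _ _ _ _ _ _ pi hpi (graded_ker hcol) _ _ _ (res1 _) res2).
- move=> v; rewrite piE -{1}[v]hsubmxK mul_row_col => /(congr1 (mulmx^~ A)).
  by rewrite mulmxDl -!mulmxA B1A -B2E mulmx0 add0r mul0mx.
- move=> w w0; have /span1 [u uE] : K1 (w *m L).
    by apply/hK1; split; [exact: graded_submoduleMx sK KL | rewrite -mulmxA -B2E].
  exists (row_mx (- u) w); last by rewrite piE row_mxKr.
  by rewrite mul_row_col mulNmx uE addNr.
- move=> v; rewrite piE; split.
    move=> [u u0 ->]; rewrite iotaE row_mxKr; split=> //.
    by rewrite mul_row_col u0 mul0mx addr0.
  rewrite -{1 3}[v]hsubmxK mul_row_col => -[vE v0].
  by exists (lsubmx v); rewrite ?iotaE -?v0 //; move: vE; rewrite v0 mul0mx addr0.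
- by move=> v _; rewrite iotaE -[RHS](row_mx0 _ 1 _ r2) => /eq_row_mx [].
Qed.

(** The generators of [K] also generate its quotient [K2] by [K1]. Their new syzygies form an
    extension of [K1] by the old syzygies, and both are resolved with bound [d + 1]. *)
Lemma resolved_quotient l d r (a : 'I_r -> int) (K1 K : 'rV[S]_r -> Prop)
    s (b : 'I_s -> int) (K2 : 'rV[S]_s -> Prop) (A : 'M_(r, s)) :
  graded_mx a b A ->
  (forall w, K2 w <-> exists2 v, K v & w = v *m A) ->
  (forall v, K1 v <-> K v /\ v *m A = 0) ->
  resolved l (d + 1) a K1 -> resolved l.+1 d a K -> resolved l.+1 d b K2.
Proof.
move=> hA hK2 hK1 res1 [t [c [B [hB hc span res]]]].
exists t, c, (B *m A); split=> //; first exact: graded_mxM hB hA.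
  move=> w; rewrite hK2; split=> [[v /span [u ->] ->]|[u ->]].
    by exists u; rewrite mulmxA.
  by exists (u *m B); [apply/span; exists u | rewrite mulmxA].
apply: (resolved_extension hB _ _ _ _ res res1).
- exact: graded_ker (graded_mxM hB hA).
- move=> v v0; apply/hK1; rewrite -mulmxA; split=> //.
  by apply/span; exists v.
- move=> w /hK1 [/span [u ->] uA]; exists u => //; by rewrite mulmxA.
- move=> v; split=> [v0|[]//]; split=> //; by rewrite mulmxA v0 mul0mx.
Qed.

End Resolutions.

(** * Monomial ideals *)

Section MonomialSets.

Variables (k : fieldType) (n : nat).
Local Notation S := {mpoly k[n]}.
Local Notation mon := 'X_{1..n}.
Implicit Types (U A B : mon -> Prop) (f m : mon) (d : int).

Definition decide (P : Prop) : bool :=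
  if excluded_middle_informative P then true else false.

Lemma decideP P : reflect P (decide P).
Proof. by rewrite /decide; case: excluded_middle_informative => h; constructor. Qed.

Definition upward_closed U := forall m m', U m -> U (m + m')%MM.

Definition supported U (p : S) := forall m, m \in msupp p -> U m.

Lemma supported0 U : supported U 0.
Proof. by move=> m; rewrite msupp0. Qed.

Lemma supportedD U p q : supported U p -> supported U q -> supported U (p + q).
Proof.
by move=> hp hq m /msuppD_le; rewrite mem_cat => /orP [/hp|/hq].
Qed.

Lemma supportedN U p : supported U p -> supported U (- p).
Proof. by move=> hp m; rewrite (perm_mem (msuppN p)) => /hp. Qed.

Lemma supportedM U p q : upward_closed U -> supported U q -> supported U (p * q).
Proof.
move=> upU hq m /msuppM_le /allpairsP [[a b] /= [_ /hq Ub ->]].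
by rewrite addmC; exact: upU.
Qed.

Lemma supportedX U m : supported U 'X_[m] <-> U m.
Proof.
split=> [|Um m']; first by apply; rewrite msuppX inE.
by rewrite msuppX inE => /eqP ->.
Qed.

Lemma supported_sub U A p :
  (forall m, U m -> A m) -> supported U p -> supported A p.
Proof. by move=> UA hp m /hp /UA. Qed.

Lemma supported_mrestrict U (P : pred mon) p :
  (forall m, m \in msupp p -> P m -> U m) -> supported U (mrestrict P p).
Proof.
move=> hU m; rewrite mcoeff_msupp mcoeff_mrestrict.
by case: ifP => [Pm mp|]; [apply: hU; rewrite ?mcoeff_msupp | rewrite eqxx].
Qed.

Lemma mrestrictC (P : pred mon) (p : S) :
  p = mrestrict P p + mrestrict (predC P) p.
Proof.
apply/mpolyP => m; rewrite mcoeffD !mcoeff_mrestrict /=.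
by case: (P m); rewrite ?addr0 ?add0r.
Qed.

Definition msubmodule U (v : 'rV[S]_1) : Prop := supported U (v 0 0).

Definition zshift : 'I_1 -> int := fun _ => 0.

Lemma graded_msubmodule U (a : 'I_1 -> int) :
  upward_closed U -> graded_submodule a (msubmodule U).
Proof.
move=> upU; split=> [|u v hu hv|p v hv|e v hv]; rewrite /msubmodule mxE.
- exact: supported0.
- exact: supportedD.
- exact: supportedM.
- by apply: supported_mrestrict => m /hv.
Qed.

(* The ideal with exponent set [U] has regularity at most d, or is zero. *)
Definition reg_bounded d U : Prop := exists l, resolved l d zshift (msubmodule U).

Lemma eq_reg_bounded d U A : (forall m, U m <-> A m) -> reg_bounded d U -> reg_bounded d A.
Proof.
move=> UA [l hl]; exists l; apply: eq_resolved hl => v.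
by split; apply: supported_sub => m /UA.
Qed.

Lemma reg_bounded_le d e U : d <= e -> reg_bounded d U -> reg_bounded e U.
Proof. by move=> de [l hl]; exists l; apply: resolved_le hl. Qed.

Lemma reg_bounded_empty d U : (forall m, ~ U m) -> reg_bounded d U.
Proof.
move=> U0; exists 0%N => v; split=> [hv|->]; last first.
  by rewrite /msubmodule mxE; exact: supported0.
apply/rowP => i; rewrite mxE (ord1 i); apply: msuppnil0.
by case E: (msupp _) => [//|m s]; case: (U0 m); apply: hv; rewrite E mem_head.
Qed.

Lemma reg_bounded_full d U : 0 <= d -> (forall m, U m) -> reg_bounded d U.
Proof.
move=> d0 hU; exists 1%N.
apply: eq_resolved (@resolved_free k n d 1 zshift _) => // v.
by split=> // _ m _.
Qed.

Definition mscale f U m := (f <= m)%MM /\ U (m - f)%MM.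

Lemma mscale_upward f U : upward_closed U -> upward_closed (mscale f U).
Proof.
move=> upU m m' [fm Um]; split; first exact: lepm_trans fm (lem_addr _ _).
suff -> : (m + m' - f = m - f + m')%MM by exact: upU.
apply/mnmP => i; rewrite !mnmE; have := mnm_lepP fm i; lia.
Qed.

Lemma supported_mscale f U p :
  supported (mscale f U) p <-> exists2 q, supported U q & p = q * 'X_[f].
Proof.
split=> [hp|[q hq ->] m]; last first.
  rewrite mcoeff_msupp => /eqP hm.
  have := msuppMX q f; move/perm_mem/(_ m).
  rewrite mcoeff_msupp; move/eqP: hm => -> /esym /mapP [m' m'q ->].
  by split; [exact: lem_addr | rewrite addmC addmK; exact: hq].
exists (\sum_(m <- msupp p) p@_m *: 'X_[m - f]).
  rewrite big_seq; apply: (big_ind (supported U)) => [|q r|m /hp [_ Um]].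
  - exact: supported0.
  - exact: supportedD.
  - by move=> m' /msuppZ_le; rewrite msuppX inE => /eqP ->.
rewrite mulr_suml {1}[p]mpolyE big_seq [RHS]big_seq; apply: eq_bigr => m /hp [fm _].
by rewrite -scalerAl -mpolyXD submK.
Qed.

Lemma reg_bounded_mscale d f U :
  upward_closed U -> reg_bounded d U -> reg_bounded (d + (mdeg f)%:Z) (mscale f U).
Proof.
move=> upU [l hl]; exists l.
have hf : graded_mx (fun i => zshift i + (mdeg f)%:Z) zshift
    ('X_[f] : S)%:M.
  move=> i j; rewrite !ord1 mxE eqxx mulr1n subr0 add0r.
  exact: homog_degX.
apply: eq_resolved (resolved_inj hf _ (graded_msubmodule _ upU)
  (resolved_shift _ hl)) => v.
  rewrite /msubmodule supported_mscale; split=> [[u hu ->]|[q hq vE]].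
    by exists (u 0 0); rewrite // mul_mx_scalar mxE mulrC.
  exists q%:M; first by rewrite mxE eqxx mulr1n.
  rewrite mul_mx_scalar; apply/rowP => i; rewrite !mxE (ord1 i) vE.
  by rewrite mulrC eqxx mulr1n.
move=> _; rewrite mul_mx_scalar => /eqP; rewrite scalemx_eq0.
by case/orP => [|/eqP //]; rewrite -msupp_eq0 msuppX.
Qed.

Lemma reg_bounded_union d A B :
  upward_closed A -> upward_closed B -> reg_bounded d A -> reg_bounded d B ->
  reg_bounded (d + 1) (fun m => A m /\ B m) -> reg_bounded d (fun m => A m \/ B m).
Proof.
move=> upA upB [l1 h1] [l2 h2] [l3 h3]; set l := maxn l1 (maxn l2 l3).
have {}h1 : resolved l.+1 d zshift (msubmodule A).
  by apply: resolved_leq h1; rewrite leqW // leq_maxl.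
have {}h2 : resolved l.+1 d zshift (msubmodule B).
  by apply: resolved_leq h2; rewrite leqW // /l maxnCA leq_maxl.
have {}h3 : resolved l (d + 1) zshift (msubmodule (fun m => A m /\ B m)).
  by apply: resolved_leq h3; rewrite /l maxnA leq_maxr.
exists l.+1.
have upAB : upward_closed (fun m => A m /\ B m).
  by move=> m m' [/upA Am /upB Bm]; split.
pose a := cat_shift zshift zshift.
pose K (v : 'rV[S]_(1 + 1)) := msubmodule A (lsubmx v) /\ msubmodule B (rsubmx v).
pose inl : 'M[S]_(1, 1 + 1) := row_mx 1%:M 0.
(* The kernel of the sum map is the intersection, embedded antidiagonally. *)
pose inrN : 'M[S]_(1, 1 + 1) := row_mx 1%:M (- 1%:M).
pose pr : 'M[S]_(1 + 1, 1) := col_mx 0 1%:M.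
pose sum : 'M[S]_(1 + 1, 1) := col_mx 1%:M 1%:M.
have hinl : graded_mx zshift a inl.
  by apply: graded_row_mx; [exact: graded_mx1 | exact: graded_mx0].
have hinrN : graded_mx zshift a inrN.
  by apply: graded_row_mx; [|apply: graded_mxN]; exact: graded_mx1.
have hpr : graded_mx a zshift pr.
  by apply: graded_col_mx; [exact: graded_mx0 | exact: graded_mx1].
have hsum : graded_mx a zshift sum.
  by apply: graded_col_mx; exact: graded_mx1.
have inlE w : w *m inl = row_mx w 0 by rewrite mul_mx_row mulmx1 mulmx0.
have inrNE w : w *m inrN = row_mx w (- w) by rewrite mul_mx_row mulmxN !mulmx1.
have prE v : v *m pr = rsubmx v.
  by rewrite -{1}[v]hsubmxK mul_row_col mulmx0 mulmx1 add0r.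
have sumE v : v *m sum = lsubmx v + rsubmx v.
  by rewrite -{1}[v]hsubmxK mul_row_col !mulmx1.
have [A0 _ _ _] := graded_msubmodule zshift upA.
have [B0 _ _ _] := graded_msubmodule zshift upB.
have sK : graded_submodule a K.
  have hl : graded_mx a zshift (col_mx 1%:M 0 : 'M[S]_(1 + 1, 1)).
    by apply: graded_col_mx; [exact: graded_mx1 | exact: graded_mx0].
  have [K0 KD KZ Kc] := graded_preim hl (graded_msubmodule zshift upA).
  have [L0 LD LZ Lc] := graded_preim hpr (graded_msubmodule zshift upB).
  have lE v : v *m (col_mx 1%:M 0 : 'M[S]_(1 + 1, 1)) = lsubmx v.
    by rewrite -{1}[v]hsubmxK mul_row_col mulmx0 mulmx1 addr0.
  split=> [|u v [uA uB] [vA vB]|p v [vA vB]|e v [vA vB]]; split.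
  - by rewrite -lE.
  - by rewrite -prE.
  - by rewrite -lE; apply: KD; rewrite lE.
  - by rewrite -prE; apply: LD; rewrite prE.
  - by rewrite -lE; apply: KZ; rewrite lE.
  - by rewrite -prE; apply: LZ; rewrite prE.
  - by rewrite -lE; apply: Kc; rewrite lE.
  - by rewrite -prE; apply: Lc; rewrite prE.
have resK : resolved l.+1 d a K.
  have {}h1 := resolved_inj hinl _ (graded_msubmodule zshift upA) h1.
  apply: (resolved_extension hpr sK _ _ _ (h1 _) h2).
  - by move=> v [_]; rewrite prE.
  - move=> w Bw; exists (row_mx 0 w); last by rewrite prE row_mxKr.
    by split; rewrite ?row_mxKl ?row_mxKr.
  - move=> v; rewrite prE; split.
      by move=> [u Au ->]; rewrite inlE /K row_mxKr row_mxKl.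
    move=> [[Av _] v0]; exists (lsubmx v) => //.
    by rewrite inlE -{1}[v]hsubmxK v0.
  - by move=> v _; rewrite inlE -[RHS](row_mx0 _ 1 _ 1) => /eq_row_mx [].
have {}h3 := resolved_inj hinrN _ (graded_msubmodule zshift upAB) h3.
apply: (resolved_quotient hsum _ _ (h3 _) resK).
- move=> w; split=> [hw|[v [vA vB] ->]]; last first.
    rewrite sumE /msubmodule mxE; apply: supportedD.
      by apply: supported_sub vA => m; left.
    by apply: supported_sub vB => m; right.
  (* A monomial lying in both sets is sent to the first summand. *)
  pose P := fun m => decide (A m).
  exists (row_mx (mrestrict P (w 0 0))%:M (mrestrict (predC P) (w 0 0))%:M).
    split; rewrite /msubmodule ?row_mxKl ?row_mxKr mxE eqxx mulr1n.
      by apply: supported_mrestrict => m _ /decideP.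
    by apply: supported_mrestrict => m /hw [Am|//] /decideP.
  rewrite sumE row_mxKl row_mxKr; apply/rowP => i.
  by rewrite !mxE (ord1 i) eqxx !mulr1n -mrestrictC.
- move=> v; rewrite sumE; split=> [[u hu ->]|[[vA vB] v0]].
    rewrite inrNE row_mxKl row_mxKr subrr; split=> //; split.
      by rewrite row_mxKl; apply: supported_sub hu => m [].
    rewrite row_mxKr /msubmodule mxE; apply: supportedN.
    by apply: supported_sub hu => m [].
  have rE : rsubmx v = - lsubmx v.
    by apply/eqP; rewrite -addr_eq0 addrC v0.
  exists (lsubmx v); last by rewrite inrNE -rE hsubmxK.
  move=> m hm; split; first exact: vA.
  by apply: vB; rewrite rE mxE (perm_mem (msuppN _)).
- by move=> v _; rewrite inrNE -[RHS](row_mx0 _ 1 _ 1) => /eq_row_mx [].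
Qed.

End MonomialSets.

(** * Colon ideals of complete intersections *)

Section ColonIdeals.

Variables (k : fieldType) (n : nat).
Local Notation mon := 'X_{1..n}.
Implicit Types (U Q : mon -> Prop) (F G : seq mon) (f g h m q : mon).
Implicit Types (v : 'I_n) (d : int).
Local Notation reg_bounded := (@reg_bounded k n).

Lemma upward_closed_le U m m' :
  upward_closed U -> (m <= m')%MM -> U m -> U m'.
Proof. by move=> upU /submK <- Um; rewrite addmC; exact: upU. Qed.

(** * Slicing an ideal by the exponent of one variable *)

Definition mset v t m : mon := [multinom if i == v then t else m i | i < n]%MM.

Lemma msetE v t m i : mset v t m i = if i == v then t else m i.
Proof. exact: mnmE. Qed.

(** Let U_t be generated by the monomials with exponent at most t in x_v, and B_t the slice at t.
    Then U_(t+1) = U_t + x_v^(t+1) B_(t+1), and the two summands meet in x_v^(t+1) B_t. The factor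
    x_v^(t+1) adds t + 1 to the slice bounds d - (t + 1) and d - t, giving d for the summand and d +
    1 for the intersection, exactly what [reg_bounded_union] asks for. *)
Lemma reg_bounded_slices U v a d :
  upward_closed U ->
  (forall m, (a <= m v)%N -> U m -> U (mset v a m)) ->
  (forall t, (t <= a)%N -> reg_bounded (d - t%:Z) (fun m => U (mset v t m))) ->
  reg_bounded d U.
Proof.
move=> upU Ua res.
(* This is U_t; the hypothesis on [a] says that U_a is all of [U]. *)
pose A t m := U (mset v (minn (m v) t) m).
have upA t : upward_closed (A t).
  move=> m m'; apply: (upward_closed_le upU); apply/mnm_lepP => i.
  by rewrite !msetE !mnmDE; case: eqP => _; lia.
suff resA t : (t <= a)%N -> reg_bounded d (A t).
  apply: eq_reg_bounded (resA a (leqnn a)) => m; split; rewrite /A.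
    apply: (upward_closed_le upU); apply/mnm_lepP => i; rewrite msetE.
    by case: eqP => [->|_]; lia.
  move=> Um; have [le_a|lt_a] := leqP a (m v).
    exact: Ua.
  apply: (upward_closed_le upU) Um; apply/mnm_lepP => i; rewrite msetE.
  by case: eqP => [->|_]; lia.
elim: t => [|t IHt] ta.
  have := res 0%N (leq0n a); rewrite subr0; apply: eq_reg_bounded => m.
  by rewrite /A minn0.
pose B t' m := U (mset v t' m).
have upB t' : upward_closed (B t').
  move=> m m'; apply: (upward_closed_le upU); apply/mnm_lepP => i.
  by rewrite !msetE !mnmDE; case: eqP => _; lia.
pose f : mon := (U_(v) *+ t.+1)%MM.
have fE i : f i = if i == v then t.+1 else 0%N.
  by rewrite mulmnE mnm1E eq_sym; case: eqP; lia.
have degf : mdeg f = t.+1 by rewrite mdegMn mdeg1 mul1n.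
have fle m : (f <= m)%MM = (t < m v)%N.
  apply/mnm_lepP/idP => [/(_ v)|tm i]; rewrite fE ?eqxx //.
  by case: eqP => [->|].
have BE t' m : B t' (m - f)%MM <-> B t' m.
  rewrite /B; suff -> : mset v t' (m - f)%MM = mset v t' m by [].
  by apply/mnmP => i; rewrite !msetE mnmBE fE; case: eqP => // _; rewrite subn0.
have resB t' : (t' <= a)%N -> reg_bounded (d - t'%:Z + t.+1%:Z) (mscale f (B t')).
  by move=> t'a; rewrite -degf; apply: reg_bounded_mscale => //; exact: res.
have := @reg_bounded_union k n d (A t) (mscale f (B t.+1)).
move=> /(_ (upA t) (mscale_upward (upB _)) (IHt (ltnW ta))).
have -> : d = d - t.+1%:Z + t.+1%:Z by rewrite subrK.
move=> /(_ (resB _ ta)).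
have -> : d - t.+1%:Z + t.+1%:Z + 1 = d - t%:Z + t.+1%:Z by lia.
move=> H; apply: eq_reg_bounded (H _) => [m|]; last first.
  apply: eq_reg_bounded (resB _ (ltnW ta)) => m; rewrite /mscale fle !BE /A /B.
  split=> [[tm Bm]|[]]; last first.
    by move=> + [tm _]; rewrite (minn_idPr (ltnW tm)).
  rewrite (minn_idPr (ltnW tm)); do 2!split=> //.
  apply: (upward_closed_le upU) Bm; apply/mnm_lepP => i; rewrite !msetE.
  by case: eqP.
rewrite /mscale fle BE /A /B; have [tm|mt] := leqP (m v) t.
  rewrite (minn_idPl (leqW tm)).
  by split=> [[//|[]//]|]; left.
rewrite (minn_idPr mt); split=> [[|[]//]|]; last by right.
apply: (upward_closed_le upU); apply/mnm_lepP => i; rewrite !msetE.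
by case: eqP.
Qed.

(** The exponents of J : Q, for J generated by [G]. Here [Q] may be any set of exponents generating
    the ideal Q, so products such as f Q need not be closed up under multiples. *)
Definition mcolon G Q m := forall q, Q q -> exists2 g, g \in G & (g <= m + q)%MM.

Lemma mcolon_upward G Q : upward_closed (mcolon G Q).
Proof.
move=> m m' hm q /hm [g gG le_g]; exists g => //.
by apply: lepm_trans le_g _; apply/mnm_lepP => i; rewrite !mnmDE; lia.
Qed.

Definition pairwise_coprime G :=
  {in G &, forall g g', g != g' -> forall v, g v = 0%N \/ g' v = 0%N}.

(** The subtraction is truncated, so this is the sum of the integers deg g - 1 only when the unit
    monomial is not in [G]. *)
Definition excess G := (\sum_(g <- G) (mdeg g - 1))%N.

(* Variables below [i] are specialised to the exponents of [h]. *)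
Definition mspec i h m : mon := [multinom if v < i then h v else m v | v < n]%MM.

Definition tail_deg i g := (\sum_(v < n | i <= v) g v)%N.

(** When this holds, a monomial of the slice is a multiple of [g] as soon as its remaining variables
    cover the tail of [g]. Such a [g] contributes its tail degree minus 1 to the bound, any other
    [g] its full tail degree. *)
Definition head_divides i g h := [forall v : 'I_n, (v < i)%N ==> (g v <= h v)%N].

Lemma tail_degS g v : tail_deg v g = (g v + tail_deg v.+1 g)%N.
Proof.
rewrite /tail_deg (bigD1 v) //=; congr addn; apply: eq_bigl => u.
by rewrite ltn_neqAle eq_sym andbC.
Qed.

Lemma head_dividesS g h v t :
  head_divides v.+1 g (mset v t h) = head_divides v g h && (g v <= t)%N.
Proof.
apply/forallP/andP => [hd|[/forallP hd gt] u].
  split; last by have := hd v; rewrite ltnSn msetE eqxx.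
  apply/forallP => u; apply/implyP => uv; have := hd u.
  by rewrite ltnS (ltnW uv) msetE ifN // -val_eqE /= neq_ltn uv.
rewrite msetE; case: (u =P v) => [->|/eqP ne]; first by rewrite gt implybT.
by rewrite ltnS leq_eqVlt (negPf ne : (u == v :> nat) = false); exact: hd.
Qed.

(* Specialising the exponent of one variable to its full value in the generator
   g involving it lowers the degree of the rest of g, and any smaller value
   makes [head_divides] fail for g, so the bound below drops accordingly. *)
Lemma reg_bounded_mcolon_spec G Q i h :
  uniq G -> pairwise_coprime G -> (i <= n)%N ->
  (forall g, g \in G -> head_divides i g h -> tail_deg i g != 0%N) ->
  reg_bounded (1 + (\sum_(g <- G) (tail_deg i g - head_divides i g h))%N%:Z)
      (fun m => mcolon G Q (mspec i h m)).
Proof.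
move=> uG cG; move/subnKC; move: (n - i)%N => j.
elim: j i h => [|j IHj] i h ijn hG.
  have cst m : mspec i h m = h.
    apply/mnmP => u; rewrite mnmE ifT //.
    by have := ltn_ord u; move: ijn; rewrite addn0 => ->.
  have [Wh|Wh] := Classical_Prop.classic (mcolon G Q h).
    by apply: reg_bounded_full => [|m]; rewrite ?cst.
  by apply: reg_bounded_empty => // m; rewrite cst.
have i_lt_n : (i < n)%N by rewrite -ijn addnS ltnS leq_addr.
pose v := Ordinal i_lt_n; have iE : i = v by [].
rewrite iE in h ijn hG *; move: {i_lt_n iE} v ijn hG => {i} v ijn hG.
set c := fun g => (tail_deg v g - head_divides v g h)%N.
have specS t m : mspec v h (mset v t m) = mspec v.+1 (mset v t h) m.
  apply/mnmP => u; rewrite !mnmE ltnS [(u <= v)%N]leq_eqVlt.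
  rewrite (erefl : (u == v :> nat) = (u == v)).
  by case: (u =P v) => [->|_] /=; rewrite ?ltnn.
(* By coprimality at most one generator involves [v]; [a] is its exponent there, or 0. Of the two
   estimates, the first serves slices that are the whole ring, the second those treated by
   induction. *)
have [a [ga hc]] : exists a, (forall g, g \in G -> (g v <= a)%N) /\
   forall t, (t <= a)%N -> (t <= 1 + \sum_(g <- G) c g)%N /\
   ((forall g, g \in G -> head_divides v.+1 g (mset v t h) ->
      tail_deg v.+1 g != 0%N) ->
    (\sum_(g <- G) (tail_deg v.+1 g - head_divides v.+1 g (mset v t h)) + t
      <= \sum_(g <- G) c g)%N).
  have [/hasP [g0 g0G g0v]|/hasPn G0] := boolP (has (fun g => g v != 0%N) G).
    have other g : g \in G -> g != g0 -> g v = 0%N.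
      move=> gG ne; have [//|g0v0] := cG _ _ gG g0G ne v.
      by rewrite g0v0 in g0v.
    exists (g0 v); split=> [g gG|t tg0].
      by have [->//|ne] := eqVneq g g0; rewrite other.
    rewrite !(bigD1_seq g0) //= /c tail_degS.
    split=> [|/(_ g0 g0G)]; first by case: head_divides; lia.
    rewrite head_dividesS => hg0.
    suff -> : (\sum_(g <- G | g != g0)
        (tail_deg v.+1 g - head_divides v.+1 g (mset v t h)) =
      \sum_(g <- G | g != g0) (tail_deg v g - head_divides v g h))%N.
      move: hg0; case: (head_divides v g0 h) => /=; last lia.
      by case: leqP => [/[swap]/(_ isT)|]; lia.
    rewrite big_seq_cond [RHS]big_seq_cond; apply: eq_bigr => g /andP [gG ne].
    by rewrite tail_degS head_dividesS (other g) // leq0n andbT.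
  exists 0%N; split=> [g /G0 /negPn /eqP -> //|t].
  rewrite leqn0 => /eqP ->; split=> // _; rewrite addn0.
  rewrite /c big_seq [leqRHS]big_seq; apply: leq_sum => g /G0 /negPn /eqP gv.
  by rewrite tail_degS head_dividesS gv leq0n andbT.
apply: (@reg_bounded_slices _ v a).
- move=> m m'; apply: upward_closed_le; first exact: mcolon_upward.
  by apply/mnm_lepP => u; rewrite !mnmE; case: ifP => // _; rewrite leq_addr.
- move=> m am Wm q /Wm [g gG le_g]; exists g => //; apply/mnm_lepP => u.
  have := mnm_lepP le_g u; rewrite !mnmE.
  case: ifP => // _; case: eqP => // -> _.
  by apply: leq_trans (leq_addr _ _); exact: ga.
move=> t /hc [tle ct].
apply: (@eq_reg_bounded _ _ _ (fun m => mcolon G Q (mspec v.+1 (mset v t h) m))).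
  by move=> m; rewrite specS.
(* A generator with dividing head and empty tail divides every monomial of the slice, which is then
   the whole ring; regularity 0 only requires the bound minus [t] to be nonnegative. *)
have [[g gG [hg tg]]|nc] := Classical_Prop.classic
    (exists2 g, g \in G & head_divides v.+1 g (mset v t h) /\ tail_deg v.+1 g = 0%N).
  apply: reg_bounded_full; first by rewrite subr_ge0 -PoszD lez_nat.
  move=> m q _; exists g => //; apply/mnm_lepP => u; rewrite !mnmDE mnmE.
  have [uv|uv] := ltnP.
    have /forallP /(_ u) := hg; rewrite uv => /= le_g.
    exact: leq_trans le_g (leq_addr _ _).
  move: tg; rewrite /tail_deg (bigD1 u) //=; lia.
have nc' g : g \in G -> head_divides v.+1 g (mset v t h) -> tail_deg v.+1 g != 0%N.
  by move=> gG hg; apply/eqP => tg; apply: nc; exists g.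
apply: reg_bounded_le (IHj _ _ _ nc'); last by rewrite addSnnS.
by have := ct nc'; rewrite lerBrDr -addrA lerD2l -PoszD lez_nat.
Qed.

(** With no variable specialised all heads are empty and hence divide, so every generator
    contributes deg g - 1. *)
Lemma reg_bounded_mcolon G Q :
  uniq G -> pairwise_coprime G -> (forall g, g \in G -> g != 0%MM) ->
  reg_bounded (1 + (excess G)%:Z) (mcolon G Q).
Proof.
move=> uG cG G0.
have tail0 g : tail_deg 0 g = mdeg g by rewrite mdegE; apply: eq_bigl.
have head0 g : head_divides 0 g 0 by apply/forallP.
have := @reg_bounded_mcolon_spec G Q 0 0%MM uG cG (leq0n n).
have -> : (\sum_(g <- G) (tail_deg 0 g - head_divides 0 g 0) = excess G)%N.
  by apply: eq_bigr => g _; rewrite tail0 head0.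
move=> H; apply: eq_reg_bounded (H _) => [m|g gG _].
  by suff -> : mspec 0 0 m = m by []; apply/mnmP => u; rewrite mnmE.
by rewrite tail0 mdeg_eq0 G0.
Qed.

(** [Q] is indexed by the generator itself rather than by its position, so that removing a generator
    causes no reindexing. *)
Definition mcolon_sum F G (Q : mon -> mon -> Prop) m :=
  exists2 f, f \in F & mscale f (mcolon G (Q f)) m.

Lemma mcolon_sum_upward F G (Q : mon -> mon -> Prop) : upward_closed (mcolon_sum F G Q).
Proof.
move=> m m' [f fF hm]; exists f => //.
by apply: mscale_upward hm; exact: mcolon_upward.
Qed.

(* For f coprime to f_i one has
   f(J : Q) \cap f_i(J : Q_i) = f f_i (J : (f Q_i + f_i Q)). *)
Lemma reg_bounded_mcolon_sum d F G (Q : mon -> mon -> Prop) :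
  (forall P, reg_bounded d (mcolon G P)) ->
  uniq F -> pairwise_coprime F -> (forall f, f \in F -> f != 0%MM) ->
  reg_bounded (d + 1 + (excess F)%:Z) (mcolon_sum F G Q).
Proof.
move=> resG; elim: F Q => [|f F IHF] Q /=.
  by move=> *; apply: reg_bounded_empty => m [].
move=> /andP [fF uF] cF F0.
have {}IHF P : reg_bounded (d + 1 + (excess F)%:Z) (mcolon_sum F G P).
  apply: IHF => // [g g' gF g'F|g gF].
    by apply: cF; rewrite inE ?gF ?g'F orbT.
  by apply: F0; rewrite inE gF orbT.
have degf : (0 < mdeg f)%N by rewrite lt0n mdeg_eq0 F0 ?mem_head.
have excE : (excess (f :: F))%:Z = (mdeg f)%:Z - 1 + (excess F)%:Z.
  by rewrite /excess big_cons PoszD -subzn.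
(* Exponents generating f Q_g + g Q_f; the induction hypothesis is used for this family as well as
   for [Q]. *)
pose P g q := (exists2 p, Q g p & q = (f + p)%MM) \/
              (exists2 p, Q f p & q = (g + p)%MM).
apply: (@eq_reg_bounded _ _ _ (fun m => mscale f (mcolon G (Q f)) m \/ mcolon_sum F G Q m)).
  move=> m; split=> [[hm|[g gF hm]]|[g]].
  - by exists f; rewrite ?mem_head.
  - by exists g; rewrite // inE gF orbT.
  - by rewrite inE => /orP [/eqP ->|gF]; [left | right; exists g].
apply: reg_bounded_union.
- exact/mscale_upward/mcolon_upward.
- exact: mcolon_sum_upward.
- have := reg_bounded_mscale f (@mcolon_upward G (Q f)) (resG (Q f)).
  by apply: reg_bounded_le; rewrite excE; lia.
- by apply: reg_bounded_le (IHF Q); rewrite excE; lia.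
(* Multiplying by f adds deg f, while f adds only deg f - 1 to the excess: the difference is the
   extra 1 allowed for an intersection. *)
have := reg_bounded_mscale f (@mcolon_sum_upward F G P) (IHF P).
have -> : d + 1 + (excess F)%:Z + (mdeg f)%:Z = d + 1 + (excess (f :: F))%:Z + 1.
  by rewrite excE; lia.
apply: eq_reg_bounded => m; split.
  move=> [fm [g gF [gm hP]]].
  have gm' : (g <= m)%MM by apply: lepm_trans gm (lem_subr _ _).
  split.
    split=> // q Qq; have [|x xG xle] := hP (g + q)%MM; first by right; exists q.
    by exists x => //; rewrite addmA submK in xle.
  exists g => //; split=> // q Qq.
  have [|x xG xle] := hP (f + q)%MM; first by left; exists q.
  exists x => //; suff <- : (m - f - g + (f + q) = m - g + q)%MM by [].
  apply/mnmP => i; rewrite !mnmE.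
  by have := mnm_lepP gm i; have := mnm_lepP fm i; rewrite mnmBE; lia.
move=> [[fm hf] [g gF [gm hg]]].
have ne : f != g by apply: contraNneq fF => ->.
have cfg i : f i = 0%N \/ g i = 0%N.
  by apply: cF => //; rewrite inE ?eqxx ?gF ?orbT.
have gm' : (g <= m - f)%MM.
  apply/mnm_lepP => i; rewrite mnmBE; have := mnm_lepP gm i.
  by have [->|->] := cfg i; lia.
split=> //; exists g => //; split=> // q [[p Qp ->]|[p Qp ->]].
  have [x xG xle] := hg p Qp; exists x => //.
  suff -> : (m - f - g + (f + p) = m - g + p)%MM by [].
  apply/mnmP => i; rewrite !mnmE.
  by have := mnm_lepP gm' i; have := mnm_lepP fm i; rewrite mnmBE; lia.
by have [x xG xle] := hf p Qp; exists x => //; rewrite addmA submK.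
Qed.

End ColonIdeals.

(** * Minimal resolutions *)

Section MinimalResolutions.

Variables (k : fieldType) (n : nat).
Local Notation S := {mpoly k[n]}.

Definition in_max r s (A : 'M[S]_(r, s)) : Prop := forall i j, (A i j)@_0 = 0.

Lemma in_maxM r s t (A : 'M[S]_(r, s)) (B : 'M_(s, t)) :
  in_max B -> in_max (A *m B).
Proof.
move=> hB i j; rewrite mxE raddf_sum big1 // => l _ /=.
by rewrite mcoeff0M hB mulr0.
Qed.

(** The bound is existential because discarding generators may raise it; the sharp one is recovered
    afterwards through [minimal_shift]. *)
Definition finitely_resolved r (a : 'I_r -> int) (K : 'rV[S]_r -> Prop) :=
  exists l d, resolved l d a K.

(* A syzygy [v] with a unit entry [v 0 j] makes generator [j] redundant, and
   dividing [ker A] by the free module it spans gives the new syzygies. *)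
Lemma minimize_generators r (a : 'I_r -> int) s (b : 'I_s -> int)
    (A : 'M[S]_(s, r)) :
  graded_mx b a A -> finitely_resolved b (fun w => w *m A = 0) ->
  exists t (c : 'I_t -> int) (B : 'M[S]_(t, r)),
    [/\ graded_mx c a B,
        forall v : 'rV_r, (exists w, v = w *m A) <-> (exists w, v = w *m B),
        forall w : 'rV_t, w *m B = 0 -> in_max w
      & finitely_resolved c (fun w => w *m B = 0)].
Proof.
elim: s b A => [|s IHs] b A hA resA.
  by exists 0%N, b, A; split=> // w _ i [].
have [[w0 [j w0A w0j]]|minA] := Classical_Prop.classic
    (exists w : 'rV_s.+1, exists2 j, w *m A = 0 & (w 0 j)@_0 != 0); last first.
  exists s.+1, b, A; split=> // w wA i j; rewrite (ord1 i).
  by apply/eqP/negPn/negP => wj; apply: minA; exists w, j.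
(* In degree [b j] the entry [j] is homogeneous of degree 0, hence a constant, and scaling makes it
   1. *)
pose v := ((w0 0 j)@_0)^-1%:MP *: hcompv b (b j) w0.
have v_homog l : homog_deg (v 0 l) (b j - b l).
  rewrite mxE -[X in homog_deg _ X]add0r; apply: homog_degM.
    apply/homog_degP => m; rewrite mcoeffC.
    by have [->|_] := eqVneq m 0%MM; rewrite ?mdeg0 // mulr0 eqxx.
  exact: hcompv_homog.
have vj : v 0 j = 1.
  rewrite (homog_deg_cst (p := v 0 j)); last by rewrite -(subrr (b j)).
  rewrite mxE mcoeffCM mxE subrr mcoeff_hcomp mdeg0 eqxx mulVf //.
have vA : v *m A = 0.
  have [_ _ _ zc] := graded_zero k n a.
  by rewrite -scalemxAl -(hcompv_mul _ _ hA) w0A zc ?scaler0.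
pose c : 'M[S]_(s.+1, 1) := delta_mx j 0.
pose E : 'M[S]_(s, s.+1) := rowsub (lift j) 1%:M.
pose E' : 'M[S]_(s.+1, s) := colsub (lift j) 1%:M.
have wc (w : 'rV_s.+1) : w *m c = (w 0 j)%:M.
  by rewrite -colE; apply/rowP => i; rewrite !mxE (ord1 i) eqxx.
have vc : v *m c = 1%:M by rewrite wc vj.
have Ec : E *m c = 0.
  rewrite mul_rowsub_mx mul1mx; apply/matrixP => i l; rewrite !mxE.
  by rewrite lift_eqF.
have EE' : E *m E' = 1%:M.
  rewrite mulmx_colsub mulmx1; apply/matrixP => i l; rewrite !mxE.
  by rewrite (inj_eq lift_inj).
have E'E (X : 'rV_s.+1) : X *m c = 0 -> X *m E' *m E = X.
  rewrite wc => /matrixP /(_ 0 0); rewrite !mxE eqxx mulr1n => Xj.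
  rewrite -[RHS]mulmx1; apply/rowP => l; rewrite !mxE.
  rewrite [RHS](bigD1_ord j) //= Xj mul0r add0r; apply: eq_bigr => i _.
  by rewrite mulmx_colsub mulmx1 !mxE.
(* Subtracting the multiple of [v] that kills coordinate [j], then deleting that coordinate: this is
   the quotient map by the span of [v]. *)
pose phi := (1%:M - c *m v) *m E'.
have hphi : graded_mx b (fun l => b (lift j l)) phi.
  have hE' : graded_mx b (fun l => b (lift j l)) E'.
    by move=> i l; rewrite mxE; exact: homog_deg_id.
  have hcv : graded_mx b b (c *m v).
    apply: (@graded_mxM _ _ _ _ _ _ (fun _ => b j)).
      move=> i l; rewrite mxE !ord1 eqxx andbT; case: eqP => [->|_].
        by rewrite subrr; exact: homog_deg1.
      exact: homog_deg0.
    by move=> i l; rewrite ord1.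
  apply: graded_mxM hE' => i l; rewrite mxE.
  by apply: homog_degD; [exact: graded_mx1 | exact: graded_mxN].
have Xc (w : 'rV_s.+1) : w *m (1%:M - c *m v) *m c = 0.
  by rewrite mulmxBr mulmx1 mulmxBl -!mulmxA vc mulmx1 subrr.
have XA (w : 'rV_s.+1) : w *m (1%:M - c *m v) *m A = w *m A.
  by rewrite mulmxBr mulmx1 mulmxBl -!mulmxA vA !mulmx0 subr0.
have phiEA (w : 'rV_s.+1) : w *m phi *m (E *m A) = w *m A.
  by rewrite !mulmxA E'E ?XA // Xc.
have hEA : graded_mx (fun l => b (lift j l)) a (E *m A).
  by move=> i l; rewrite mul_rowsub_mx mul1mx mxE.
have resEA : finitely_resolved (fun l => b (lift j l)) (fun w => w *m (E *m A) = 0).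
  have [l [d hl]] := resA.
  (* The kernel of [E *m A] is that of [A] modulo the multiples of [v]. These form a free module
     with shift [b j], which [resolved_quotient] wants to be at most [e + 1]. *)
  have [e be de] : exists2 e : int, b j <= e + 1 & d <= e.
    by exists (Num.max (b j) d); rewrite ?ler_wpDr // le_max lexx ?orbT.
  have hvm : graded_mx (fun _ : 'I_1 => b j) b v by move=> i l'; rewrite (ord1 i).
  have res1 : resolved 1 (e + 1) (fun _ : 'I_1 => b j) (fun _ : 'rV[S]_1 => True).
    exact: resolved_free.
  have {}res1 : resolved l.+1 (e + 1) b (fun w => exists2 p, True & w = p *m v).
    apply: (@resolved_leq _ _ 1) => //; apply: resolved_inj hvm _ _ res1 => //.
    by move=> p _ /(congr1 (mulmx^~ c)); rewrite -mulmxA vc mulmx1 mul0mx.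
  have {}hl : resolved l.+2 e b (fun w => w *m A = 0).
    exact: resolved_le de (resolved_leq (leqW (leqnSn l)) hl).
  exists l.+2, e; apply: resolved_quotient hphi _ _ res1 hl => w.
    split=> [w0E|[u uA ->]]; last by rewrite phiEA.
    exists (w *m E); first by rewrite -mulmxA.
    by rewrite mulmxA mulmxBr mulmx1 [w *m E *m (c *m v)]mulmxA -[w *m E *m c]mulmxA
      Ec mulmx0 mul0mx subr0 -mulmxA EE' mulmx1.
  split=> [[p _ ->]|[wA wphi]].
    rewrite -mulmxA vA mulmx0 /phi; split=> //.
    by rewrite mulmxA mulmxBr mulmx1 [p *m v *m (c *m v)]mulmxA -[p *m v *m c]mulmxA
      vc mulmx1 subrr mul0mx.
  exists (w *m c) => //; apply/eqP; rewrite -subr_eq0.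
  have := E'E _ (Xc w); rewrite -[w *m _ *m E']mulmxA wphi mul0mx.
  by rewrite mulmxBr mulmx1 mulmxA => <-.
have [t [c' [B [hB spanB minB resB]]]] := IHs _ _ hEA resEA.
exists t, c', B; split=> // u; rewrite -spanB; split=> [[w ->]|[w ->]].
  by exists (w *m phi); rewrite phiEA.
by exists (w *m E); rewrite mulmxA.
Qed.

(** * Iterated syzygies *)

Section Unfold.

Definition gen_data r := {s : nat & (('I_s -> int) * 'M[S]_(s, r))%type}.

Definition presents r (a : 'I_r -> int) (K : 'rV[S]_r -> Prop)
    (t : gen_data r) : Prop :=
  graded_mx (tagged t).1 a (tagged t).2 /\
  forall v, K v <-> exists w, v = w *m (tagged t).2.

Definition syzygy r (t : gen_data r) (w : 'rV[S]_(tag t)) : Prop :=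
  w *m (tagged t).2 = 0.

Variable P : nat -> forall r, ('I_r -> int) -> ('rV[S]_r -> Prop) -> Prop.

Hypothesis P_step : forall i r (a : 'I_r -> int) K, P i a K ->
  exists t, presents a K t /\ P i.+1 (tagged t).1 (@syzygy r t).

Record stage i := Stage {
  stage_rank : nat;
  stage_shift : 'I_stage_rank -> int;
  stage_module : 'rV[S]_stage_rank -> Prop;
  stageP : P i stage_shift stage_module
}.

Definition stage_gens i (x : stage i) :=
  constructive_indefinite_description _ (P_step (stageP x)).

Definition next_stage i (x : stage i) : stage i.+1 :=
  Stage (proj2 (proj2_sig (stage_gens x))).

(** Dependent choice along an invariant [P] that passes from a module to the syzygies of suitable
    generators. [P] is returned for every syzygy module, so that shift bounds or minimality can be
    read off from it. *)
Lemma unfold_resolution (I : S -> Prop) :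
  P 0 (zshift) (fun v => I (v 0 0)) ->
  exists F : free_complex k n,
    [/\ graded F, resolves F I,
        P 1 (@shift _ _ F 0) (fun w => w *m aug F = 0)
      & forall i, P i.+2 (@shift _ _ F i.+1) (fun w => w *m diff F i = 0)].
Proof.
move=> P0; pose x0 : stage 0 := Stage P0.
pose fix st i : stage i := if i is i'.+1 then next_stage (st i') else x0.
pose t i := proj1_sig (stage_gens (st i)).
have tP i : presents (@stage_shift _ (st i)) (@stage_module _ (st i)) (t i).
  exact: proj1 (proj2_sig (stage_gens (st i))).
pose F := @FreeComplex k n (fun i => tag (t i)) (fun i => (tagged (t i)).1)
  (tagged (t 0%N)).2 (fun i => (tagged (t i.+1)).2).
exists F; split.
- split=> [j|i j l].
    have [/(_ j 0)] := tP 0%N; rewrite subr0; exact.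
  by have [/(_ j l)] := tP i.+1.
- split=> [p|v|i v].
  + have [_ h] := tP 0%N; have := h (\row_(_ < 1) p); rewrite /= mxE => ->.
    split=> [[w wE]|[w ->]]; exists w; first by rewrite -wE mxE.
    by apply/rowP => i; rewrite mxE (ord1 i).
  + by have [_ /(_ v)] := tP 1%N.
  + by have [_ /(_ v)] := tP i.+2.
- exact: stageP (st 1%N).
- move=> i; exact: stageP (st i.+2).
Qed.

End Unfold.

Lemma finite_resolution l d U :
  resolved l d zshift (@msubmodule k n U) ->
  exists F : free_complex k n,
    [/\ graded F, resolves F (supported U),
        forall i j, @shift _ _ F i j <= d + i%:Z
      & forall i, (l <= i)%N -> rank F i = 0%N].
Proof.
move=> hl.
(* At stage [i > 0] the ambient free module is F_(i-1), whence the bound [d + i - 1] on its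
   shifts. *)
pose P i r (a : 'I_r -> int) (K : 'rV[S]_r -> Prop) :=
  [/\ resolved (l - i) (d + i%:Z) a K,
      forall j, (0 < i)%N -> a j <= d + i%:Z - 1 & (l < i)%N -> r = 0%N].
have [||F [gF rF P1 PS]] := @unfold_resolution P _ (supported U).
- move=> i r a K [resK _ _]; case E: (l - i)%N resK => [|m] /=.
    move=> K0; exists (existT _ 0%N (fun _ => 0, 0)); split; first split=> /=.
    + by case.
    + move=> v; rewrite K0; split=> [->|[w ->]]; last by rewrite mulmx0.
      by exists 0; rewrite mulmx0.
    split=> [|[]|] //; have -> : (l - i.+1 = 0)%N by lia.
    by move=> /= w; rewrite [w]thinmx0; split=> // _; rewrite /syzygy mul0mx.
  move=> [s [b [A [hA hb span resA]]]].
  exists (existT _ s (b, A)); split; first by split.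
  split=> /= [|j _|]; last by lia.
    have -> : (l - i.+1 = m)%N by lia.
    by rewrite -addn1 PoszD addrA.
  by rewrite -addn1 PoszD addrA addrK.
- by split=> //; rewrite subn0 addr0.
exists F; split=> // [[|i] j|[|i]] => [|||li].
- by have [_ /(_ j isT) le_j _] := P1; apply: le_trans le_j _; lia.
- by have [_ /(_ j isT) le_j _] := PS i; apply: le_trans le_j _; lia.
- by have [_ _ h] := P1; move=> l0; apply: h; lia.
- by have [_ _ h] := PS i; apply: h; lia.
Qed.

(** The rows of each differential are relations among generators chosen by [minimize_generators], so
    their entries lie in the maximal ideal. Finite length comes later, by comparison with a finite
    resolution. *)
Lemma minimal_free_resolution (I : S -> Prop) :
  finitely_resolved zshift (fun v : 'rV_1 => I (v 0 0)) ->
  exists F : free_complex k n, [/\ graded F, resolves F I & minimal F].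
Proof.
move=> resI.
pose P i r (a : 'I_r -> int) (K : 'rV[S]_r -> Prop) :=
  finitely_resolved a K /\ ((0 < i)%N -> forall w, K w -> in_max w).
have [||F [gF rF P1 PS]] := @unfold_resolution P _ I.
- move=> i r a K [[l [d]] resK _]; case: l resK => [|l] /=.
    move=> K0; exists (existT _ 0%N (fun _ => 0, 0)); split; first split=> /=.
    + by case.
    + move=> v; rewrite K0; split=> [->|[w ->]]; last by rewrite mulmx0.
      by exists 0; rewrite mulmx0.
    split=> [|_ w _ j []] //; exists 0%N, d => /= w.
    by rewrite [w]thinmx0; split=> // _; rewrite /syzygy mul0mx.
  move=> [s [b [A [hA hb span resA]]]].
  have [|t [c [B [hB spanB minB resB]]]] := minimize_generators hA.
    by exists l, (d + 1).
  exists (existT _ t (c, B)); split; last by split.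
  by split=> //= v; rewrite span spanB.
- by split.
exists F; split=> // i j l; have [_ exact0 exactS] := rF.
have rowE' : row j (diff F i) = delta_mx 0 j *m diff F i by rewrite rowE.
have : in_max (row j (diff F i)).
  case: i j l rowE' => [|i] j l rowE'.
    by case: P1 => _; apply=> //; apply/exact0; eexists; exact: rowE'.
  by case: (PS i) => _; apply=> //; apply/exactS; eexists; exact: rowE'.
by move/(_ 0 l); rewrite mxE.
Qed.

(* Comparison maps between two resolutions, the composite from the first to
   itself being homotopic to the identity up to the term [Y]. *)
Definition comparable p0 p1 q0 q1 (a : 'I_p1 -> int) (b : 'I_q1 -> int)
    (D : 'M[S]_(p1, p0)) (D' : 'M[S]_(q1, q0)) : Prop :=
  exists alpha : 'M[S]_(p1, q1), exists beta : 'M[S]_(q1, p1),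
  exists Y : 'M[S]_p1,
    [/\ graded_mx a b alpha,
        forall v : 'rV_p1, v *m D = 0 -> v *m alpha *m D' = 0,
        forall v : 'rV_q1, v *m D' = 0 -> v *m beta *m D = 0
      & [/\ in_max Y, forall v : 'rV_p1, v *m D = 0 -> v *m Y = 0
          & (alpha *m beta - 1%:M - Y) *m D = 0]].

Definition exact_at p0 p1 p2 (D : 'M[S]_(p1, p0)) (E : 'M[S]_(p2, p1)) : Prop :=
  forall v : 'rV_p1, v *m D = 0 <-> exists w, v = w *m E.

Lemma exact_at_mul p0 p1 p2 (D : 'M[S]_(p1, p0)) (E : 'M[S]_(p2, p1)) :
  exact_at D E -> E *m D = 0.
Proof.
move=> ex; apply/row_matrixP => i; rewrite row_mul row0.
by apply/ex; exists (delta_mx 0 i); rewrite rowE.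
Qed.

Lemma exact_at_lift p0 p1 p2 s (D : 'M[S]_(p1, p0)) (E : 'M[S]_(p2, p1))
    (X : 'M[S]_(s, p1)) :
  exact_at D E -> X *m D = 0 -> exists Z, X = Z *m E.
Proof.
move=> ex XD.
have /fin_all_exists [Z hZ] i : exists w, row i X = w *m E.
  by apply/ex; rewrite -row_mul XD row0.
exists (\matrix_i Z i); apply/row_matrixP => i.
by rewrite row_mul rowK hZ.
Qed.

(** The homotopy [h] with [al *m be - 1%:M - Y = h *m E] yields the next correction term [E *m h],
    which is in the maximal ideal because [E] is. *)
Lemma comparable_step p0 p1 p2 q0 q1 q2 a a' b b'
    (D : 'M_(p1, p0)) (E : 'M_(p2, p1)) (D' : 'M_(q1, q0)) (E' : 'M_(q2, q1)) :
  exact_at D E -> exact_at D' E' -> in_max E -> graded_mx a' a E ->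
  graded_mx b' b E' ->
  comparable a b D D' -> comparable a' b' E E'.
Proof.
move=> ex ex' maxE hE hE' [al [be [Y [hal alK beK [maxY YK hom]]]]].
have ED := exact_at_mul ex; have ED' := exact_at_mul ex'.
have [|al' [hal' al'E _]] := graded_lift (graded_full k n b') hE'
    (graded_mxM hE hal).
  move=> i; suff [w wE] : exists w, row i (E *m al) = w *m E' by exists w.
  apply/ex'; rewrite row_mul; apply: alK.
  by rewrite -row_mul ED row0.
have [|be' be'E] := @exact_at_lift _ _ _ _ _ _ (E' *m be) ex.
  apply/row_matrixP => i; rewrite row_mul row0 row_mul; apply: beK.
  by rewrite -row_mul ED' row0.
have [h hE0] := exact_at_lift ex hom.
exists al', be', (E *m h); split=> //.
- by move=> v vE; rewrite -mulmxA -al'E mulmxA vE mul0mx.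
- by move=> v vE; rewrite -mulmxA -be'E mulmxA vE mul0mx.
split.
- move=> i j; rewrite mxE raddf_sum big1 // => l _ /=.
  by rewrite mcoeff0M maxE mul0r.
- by move=> v vE; rewrite mulmxA vE mul0mx.
have EY : E *m Y = 0.
  apply/row_matrixP => i; rewrite row_mul row0; apply: YK.
  by rewrite -row_mul ED row0.
rewrite !mulmxBl mul1mx -!mulmxA -be'E -hE0 mulmxA -al'E.
by rewrite !mulmxBr mulmx1 EY subr0 !mulmxA subrr.
Qed.

(** Modulo the maximal ideal [al *m be] is the identity, so row [j] of [al] has an entry with
    nonzero constant term; being homogeneous of degree [a j - b l], it forces equality. *)
Lemma comparable_shift p0 p1 p2 q0 q1 (a : 'I_p1 -> int) (b : 'I_q1 -> int)
    (D : 'M_(p1, p0)) (E : 'M_(p2, p1)) (D' : 'M_(q1, q0)) :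
  exact_at D E -> in_max E -> comparable a b D D' -> forall j, exists l, a j = b l.
Proof.
move=> ex maxE [al [be [Y [hal _ _ [maxY _ hom]]]]] j.
have [h hE] := exact_at_lift ex hom.
have : ((al *m be) j j)@_0 = 1.
  have -> : al *m be = h *m E + Y + 1%:M by rewrite -hE !subrK.
  rewrite mxE mcoeffD mxE mcoeffD (in_maxM _ maxE) maxY mxE eqxx mcoeff1 eqxx.
  by rewrite !add0r.
rewrite mxE raddf_sum /= => sum1.
have [l hl|al0] := pickP (fun l => (al j l)@_0 != 0).
  by exists l; apply/eqP; rewrite -subr_eq0 (homog_deg_mcoeff0 (hal j l) hl).
have /eqP := oner_neq0 k; rewrite -sum1 big1 // => l _.
by rewrite mcoeff0M; move/negbFE: (al0 l) => /eqP ->; rewrite mul0r.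
Qed.

Lemma minimal_shift (I : S -> Prop) (F G : free_complex k n) :
  graded F -> resolves F I -> minimal F -> graded G -> resolves G I ->
  forall i j, exists l, @shift _ _ F i j = @shift _ _ G i l.
Proof.
move=> [gF0 gFS] [rF0 rF1 rFS] mF [gG0 gGS] [rG0 rG1 rGS].
have gaug (H : free_complex k n) : (forall j, homog_deg (aug H j 0) (shift j)) ->
    graded_mx (@shift _ _ H 0) zshift (aug H).
  by move=> gH j l; rewrite (ord1 l) subr0.
have aug_in (H : free_complex k n) j : 
    (forall p, I p <-> exists v : 'rV_(rank H 0), p = (v *m aug H) 0 0) ->
    I (aug H j 0).
  move=> rH; apply/rH; exists (delta_mx 0 j).
  by have /rowP /(_ 0) := rowE j (aug H); rewrite mxE.
have cmp0 : comparable (@shift _ _ F 0) (@shift _ _ G 0) (aug F) (aug G).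
  have [|al [hal alE _]] := graded_lift (graded_full k n _) (gaug G gG0) (gaug F gF0).
    move=> j; have /rG0 [w wE] := aug_in F j rF0; exists w => //.
    by apply/rowP => l; rewrite mxE (ord1 l).
  have /fin_all_exists [be hbe] j : exists w, row j (aug G) = w *m aug F.
    have /rF0 [w wE] := aug_in G j rG0; exists w.
    by apply/rowP => l; rewrite mxE (ord1 l).
  have beE : aug G = (\matrix_j be j) *m aug F.
    by apply/row_matrixP => j; rewrite row_mul rowK hbe.
  (* Both maps lift the identity of I, so their composite fixes [aug F] exactly and the correction
     starts at 0. *)
  exists al, (\matrix_j be j), 0; split=> //.
  - by move=> v v0; rewrite -mulmxA -alE.
  - by move=> v v0; rewrite -mulmxA -beE.
  split=> [i j|v _|]; first by rewrite mxE mcoeff0.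
    by rewrite mulmx0.
  by rewrite subr0 mulmxBl mul1mx -mulmxA -beE -alE subrr.
have cmpS i : comparable (@shift _ _ F i.+1) (@shift _ _ G i.+1) (diff F i) (diff G i).
  elim: i => [|i IHi].
    exact: (comparable_step rF1 rG1 (@mF 0%N) (@gFS 0%N) (@gGS 0%N) cmp0).
  exact: (comparable_step (rFS i) (rGS i) (@mF i.+1) (@gFS i.+1) (@gGS i.+1) IHi).
case=> [|i]; first exact: comparable_shift rF1 (@mF 0%N) cmp0.
exact: comparable_shift (rFS i) (@mF i.+1) (cmpS i).
Qed.

End MinimalResolutions.

(** * Koszul complexes *)

Section Koszul.

Variables (k : fieldType) (n : nat).
Local Notation S := {mpoly k[n]}.
Local Notation mon := 'X_{1..n}.

Lemma in_max_col_mx r s t (A : 'M[S]_(r, t)) (B : 'M_(s, t)) :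
  in_max A -> in_max B -> in_max (col_mx A B).
Proof.
by move=> hA hB i j; case: (split_ordP i) => l ->; rewrite ?col_mxEu ?col_mxEd.
Qed.

Lemma in_max_row_mx r s t (A : 'M[S]_(t, r)) (B : 'M_(t, s)) :
  in_max A -> in_max B -> in_max (row_mx A B).
Proof.
by move=> hA hB i j; case: (split_ordP j) => l ->; rewrite ?row_mxEl ?row_mxEr.
Qed.

Lemma in_max_scalar r (p : S) : p@_0 = 0 -> in_max (p%:M : 'M_r).
Proof. by move=> p0 i j; rewrite mxE; case: eqP; rewrite ?mulr1n ?mcoeff0. Qed.

(* The resolution of S/I: [F] with S prepended in position 0. *)
Definition crank (F : free_complex k n) i := if i is i'.+1 then rank F i' else 1%N.

Definition cshift (F : free_complex k n) i : 'I_(crank F i) -> int :=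
  match i with 0 => zshift | i'.+1 => @shift _ _ F i' end.

Definition cdiff (F : free_complex k n) i : 'M[S]_(rank F i, crank F i) :=
  match i with 0 => aug F | i'.+1 => diff F i' end.

(* The mapping cone of multiplication by X^f on the resolution of S/I. *)
Definition cone (F : free_complex k n) (f : mon) : free_complex k n :=
  @FreeComplex k n (fun i => rank F i + crank F i)%N
    (fun i => cat_shift (@shift _ _ F i)
                        (fun j => @cshift F i j + (mdeg f)%:Z))
    (col_mx (aug F) 'X_[f]%:M)
    (fun i => block_mx (diff F i) 0 ('X_[f]%:M) (- cdiff F i)).

Lemma cdiff_exact (F : free_complex k n) I i :
  resolves F I -> exact_at (cdiff F i) (diff F i).
Proof. by case=> _ ex0 exS; case: i. Qed.

(** The hypothesis makes [a + f *: c] a cycle, say [e *m E]; then [row_mx e (- c)] is the required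
    preimage. *)
Lemma cone_exact p0 p1 p2 (D : 'M[S]_(p1, p0)) (E : 'M[S]_(p2, p1)) (f : S)
    (a c : 'rV_p1) :
  exact_at D E -> a *m D + (c *m D) *m f%:M = 0 ->
  exists w, row_mx a (c *m D) = w *m block_mx E 0 f%:M (- D).
Proof.
move=> ex h; have /ex [e eE] : (a + f *: c) *m D = 0.
  by rewrite mulmxDl -scalemxAl -mul_mx_scalar.
exists (row_mx e (- c)).
rewrite mul_row_block mulmx0 add0r !mulNmx mulmxN opprK mul_mx_scalar.
by rewrite -eE addrK.
Qed.

Lemma cone_graded F f : graded F -> graded (cone F f).
Proof.
move=> [gF0 gFS].
have hf r (a : 'I_r -> int) :
    graded_mx (fun j => a j + (mdeg f)%:Z) a ('X_[f] : S)%:M.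
  move=> i j; rewrite mxE; case: eqP => [->|_]; last exact: homog_deg0.
  by rewrite mulr1n addrAC subrr add0r; exact: homog_degX.
have gaug : graded_mx (@shift _ _ F 0) zshift (aug F).
  by move=> j l; rewrite (ord1 l) subr0.
split=> [j|i].
  rewrite /= -[X in homog_deg _ X]subr0; move: j.
  suff h : graded_mx (@shift _ _ (cone F f) 0) zshift (aug (cone F f)).
    by move=> j; exact: (h j 0).
  by apply: graded_col_mx.
suff h : graded_mx (@shift _ _ (cone F f) i.+1) (@shift _ _ (cone F f) i)
    (diff (cone F f) i) by [].
apply: graded_col_mx; apply: graded_row_mx => //.
- exact: graded_mx0.
- apply: graded_mxN => j l.
  rewrite opprD addrACA subrr addr0.
  by case: i j l => [|i] j l /=; [exact: gaug | exact: gFS].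
Qed.

Lemma cone_finite_length F f : finite_length F -> finite_length (cone F f).
Proof.
by move=> [m hm]; exists m.+1 => -[|i] //= mi; rewrite !hm // ltnW.
Qed.

(** The first alternative covers the cone over the zero complex, where f = 1 is allowed and gives
    the unit ideal. *)
Lemma cone_minimal F f :
  minimal F -> (forall i, rank F i = 0%N) \/ in_max (aug F) /\ f != 0%MM ->
  minimal (cone F f).
Proof.
move=> mF [F0 i j l|[maxF f0] i].
  by case: (split_ordP j) => x; have := ltn_ord x; rewrite [X in (_ < X)%N]F0.
apply: in_max_col_mx; apply: in_max_row_mx; first exact: mF.
- by move=> j l; rewrite mxE mcoeff0.
- by apply: in_max_scalar; rewrite mcoeffX (negPf f0).
move=> j l; rewrite mxE mcoeffN; apply/eqP; rewrite oppr_eq0; apply/eqP.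
by case: i j l => [|i] j l /=; [exact: maxF | exact: mF].
Qed.

Lemma cone_resolves F f I I' :
  resolves F I -> (forall p, I (p * 'X_[f]) -> I p) ->
  (forall p, I p -> I (- p)) ->
  (forall p, I' p <-> exists a b, I a /\ p = a + b * 'X_[f]) ->
  resolves (cone F f) I'.
Proof.
move=> rF nzd IN I'E.
have ex i : exact_at (cdiff F i) (diff F i).
  exact: cdiff_exact rF.
have [rF0 _ _] := rF.
have zero p0 p1 p2 (D : 'M[S]_(p1, p0)) (E : 'M[S]_(p2, p1)) :
    exact_at D E -> block_mx E 0 'X_[f]%:M (- D) *m col_mx D 'X_[f]%:M = 0.
  move=> exDE; rewrite mul_block_col mul0mx addr0 (exact_at_mul exDE).
  by rewrite mulNmx mul_mx_scalar mul_scalar_mx subrr col_mx0.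
split.
- move=> p; rewrite I'E; split=> [[a [b [/rF0 [v ->] ->]]]|[v ->]].
    exists (row_mx v b%:M); rewrite /= mul_row_col [RHS]mxE; congr (_ + _).
    by rewrite mul_mx_scalar !mxE eqxx mulr1n mulrC.
  exists ((lsubmx v *m aug F) 0 0), (rsubmx v 0 0); split.
    by apply/rF0; exists (lsubmx v).
  rewrite /= -{1}[v]hsubmxK mul_row_col [LHS]mxE; congr (_ + _).
  by rewrite mul_mx_scalar !mxE mulrC.
- move=> v; split=> [|[w ->]]; last by rewrite /= -mulmxA (zero _ _ _ _ _ (ex 0%N)) mulmx0.
  rewrite /= -[v]hsubmxK mul_row_col => v0.
  have /rF0 [c cE] : I (rsubmx v 0 0).
    apply: nzd; rewrite -[_ * _]opprK; apply: IN; apply/rF0; exists (lsubmx v).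
    have := v0; rewrite mul_mx_scalar => /eqP; rewrite addr_eq0 => /eqP ->.
    by rewrite !mxE mulrC.
  have rE : rsubmx v = c *m aug F by apply/rowP => i; rewrite (ord1 i) cE.
  by rewrite rE in v0 *; exact: cone_exact (ex 0%N) v0.
move=> i v; split=> [|[w ->]]; last first.
  rewrite -mulmxA /= mulmx_block !mul0mx !mulmx0 !addr0 !add0r.
  rewrite (exact_at_mul (ex i.+1)) mulNmx mul_mx_scalar mul_scalar_mx subrr.
  rewrite mulmxN mulNmx opprK (exact_at_mul (ex i)).
  by rewrite block_mx0 mulmx0.
rewrite /= -[v]hsubmxK mul_row_block mulmx0 add0r mulmxN.
rewrite -[RHS](row_mx0 _ 1 _ _) => /eq_row_mx [v0 /eqP].
rewrite oppr_eq0 => /eqP /(ex i) [c cE].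
by rewrite cE in v0 *; exact: cone_exact (ex i.+1) v0.
Qed.

Definition mgen (s : seq mon) (m : mon) := exists2 g, g \in s & (g <= m)%MM.

Lemma mgen_upward s : upward_closed (mgen s).
Proof.
by move=> m m' [g gs le_g]; exists g => //; exact: lepm_trans le_g (lem_addr _ _).
Qed.

Lemma mem_msuppMX (p : S) m f : m \in msupp p -> (m + f)%MM \in msupp (p * 'X_[f]).
Proof. by rewrite !mcoeff_msupp addmC mcoeffMX. Qed.

Lemma cone_mgen F f s :
  pairwise_coprime (f :: s) -> f \notin s ->
  resolves F (supported (mgen s)) -> resolves (cone F f) (supported (mgen (f :: s))).
Proof.
move=> cs fs rF; apply: (cone_resolves rF).
- move=> p hp m /(mem_msuppMX f) /hp [g gs le_g]; exists g => //.
  apply/mnm_lepP => i; have := mnm_lepP le_g i; rewrite mnmDE.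
  have ne : g != f by apply/eqP => gf; rewrite -gf gs in fs.
  have [->//|->] : g i = 0%N \/ f i = 0%N.
    by apply: cs; rewrite // inE ?eqxx ?gs ?orbT.
  by rewrite addn0.
- exact: supportedN.
move=> p; split=> [hp|[a [b [ha ->]]]]; last first.
  apply: supportedD; first by apply: supported_sub ha => m [g gs le_g];
    exists g; rewrite // inE gs orbT.
  apply: supportedM; first exact: mgen_upward.
  by apply/supportedX; exists f; rewrite ?mem_head ?lepm_refl.
have /supported_mscale [q _ qE] : supported (mscale f (fun _ => True))
    (mrestrict (fun m => (f <= m)%MM) p).
  by apply: supported_mrestrict.
exists (mrestrict (predC (fun m => (f <= m)%MM)) p), q; split; last first.
  by rewrite -qE addrC -mrestrictC.
apply: supported_mrestrict => m /hp [g].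
by rewrite inE => /orP [/eqP ->|gs] le_g /=; [rewrite le_g | exists g].
Qed.

Definition zero_complex : free_complex k n :=
  @FreeComplex k n (fun _ => 0%N) (fun _ _ => 0) 0 (fun _ => 0).

Lemma zero_complex_resolution :
  minimal_graded_free_resolution zero_complex (supported (mgen [::])).
Proof.
split=> [||| i []] //; [by split=> [[]|i []] | by exists 0%N | split].
- move=> p; split=> [hp|[v ->]]; last first.
    by rewrite mulmx0 mxE; exact: supported0.
  exists 0; rewrite mulmx0 mxE; apply: msuppnil0.
  by case E: (msupp p) => [//|m s]; have [] := hp m; rewrite ?E ?mem_head.
- move=> v; rewrite [v]thinmx0 mul0mx; split=> // _; exists 0.
  by rewrite mulmx0.
- move=> i v; rewrite [v]thinmx0 mul0mx; split=> // _; exists 0.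
  by rewrite mulmx0.
Qed.

Lemma koszul_cone F f s :
  pairwise_coprime (f :: s) -> f \notin s ->
  (forall i, rank F i = 0%N) \/ in_max (aug F) /\ f != 0%MM ->
  minimal_graded_free_resolution F (supported (mgen s)) ->
  minimal_graded_free_resolution (cone F f) (supported (mgen (f :: s))).
Proof.
move=> cs fs hF [gF lF rF mF]; split.
- exact: cone_graded.
- exact: cone_finite_length.
- exact: cone_mgen.
- exact: cone_minimal.
Qed.

Lemma cone_top F f i (j : 'I_(crank F i)) :
  exists l, @cshift (cone F f) i.+1 l = cshift j + (mdeg f)%:Z.
Proof. by exists (rshift _ j); rewrite /= cat_shiftr. Qed.

Lemma koszul_resolution (s : seq mon) :
  uniq s -> pairwise_coprime s ->
  (forall f, f \in s -> f != 0%MM) \/ s = [:: 0%MM] ->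
  exists F, minimal_graded_free_resolution F (supported (mgen s)) /\
    exists j : 'I_(crank F (size s)), cshift j = (\sum_(f <- s) mdeg f)%N%:Z.
Proof.
have Z := zero_complex_resolution.
move=> us cs [s0|sE]; last first.
  exists (cone zero_complex 0%MM); rewrite {us}sE in cs *.
  split; first by apply: koszul_cone => //; left.
  have [l lE] := @cone_top zero_complex 0%MM 0 ord0.
  by exists l; rewrite lE big_seq1.
suff [F [hF _ hj]] : exists F, [/\ minimal_graded_free_resolution F (supported (mgen s)),
    in_max (aug F) &
    exists j : 'I_(crank F (size s)), cshift j = (\sum_(f <- s) mdeg f)%N%:Z].
  by exists F.
elim: s us cs s0 => [|f s IHs] /=.
  by move=> *; exists zero_complex; split=> // [[]//|]; exists (ord0 : 'I_1); rewrite big_nil.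
move=> /andP [fs us] cs s0.
have [||F [hF maxF [j jE]]] := IHs us.
- by move=> g g' gs g's; apply: cs; rewrite inE ?gs ?g's orbT.
- by move=> g gs; apply: s0; rewrite inE gs orbT.
have f0 : f != 0%MM by apply: s0; rewrite mem_head.
exists (cone F f); split.
- by apply: koszul_cone => //; right.
- apply: in_max_col_mx => //; apply: in_max_scalar.
  by rewrite mcoeffX (negPf f0).
by have [l lE] := cone_top f j; exists l; rewrite big_cons PoszD addrC -jE; exact: lE.
Qed.

End Koszul.

(** * Regularity *)

Section Regularity.

Variables (k : fieldType) (n : nat).
Local Notation S := {mpoly k[n]}.
Local Notation mon := 'X_{1..n}.

Lemma eq_resolves (F : free_complex k n) (I I' : S -> Prop) :
  (forall p, I p <-> I' p) -> resolves F I -> resolves F I'.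
Proof. by move=> II' [h0 h1 h2]; split=> // p; rewrite -II'. Qed.

Lemma exists_maximum (s : seq int) :
  s != [::] -> exists2 x, x \in s & {in s, forall y, y <= x}.
Proof.
elim: s => [//|x s IHs] _; have [->|/IHs [y ys maxy]] := eqVneq s [::].
  by exists x; rewrite ?mem_head // => y; rewrite inE => /eqP ->.
exists (Num.max x y).
  by rewrite inE /Num.max; case: ifP; rewrite ?ys ?orbT ?eqxx.
by move=> z; rewrite inE le_max => /orP [/eqP ->|/maxy ->]; rewrite ?lexx ?orbT.
Qed.

(** This is what makes the chosen value [reg] usable: finite length leaves finitely many values
    [shift j - i], and a nonzero element of I ensures that there is one. *)
Lemma is_regularity_exists (F : free_complex k n) (I : S -> Prop) :
  minimal_graded_free_resolution F I -> (exists2 p, I p & p != 0) ->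
  is_regularity I (reg I).
Proof.
move=> hF [p Ip p0]; apply: epsilon_spec.
have [gF [m lF] [rF _ _] mF] := hF.
pose s := flatten [seq [seq @shift _ _ F i j - i%:Z | j <- enum 'I_(rank F i)]
                  | i <- iota 0 m.+1].
have mem_s i (j : 'I_(rank F i)) : shift j - i%:Z \in s.
  apply/flatten_mapP; exists i; last first.
    by apply/mapP; exists j; rewrite ?mem_enum.
  rewrite mem_iota add0n /= ltnS leqNgt; apply/negP => /lF ri.
  by have := ltn_ord j; rewrite [X in (_ < X)%N]ri.
have [|d ds maxd] := @exists_maximum s.
  apply: contraNneq p0 => s0; have /rF [v ->] := Ip.
  rewrite mxE big1 // => j _.
  by have := mem_s 0%N j; rewrite s0.
exists d, F; split=> //; last by move=> i j; exact: maxd.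
by move/flatten_mapP: ds => [i _ /mapP [j _ ->]]; exists i, j.
Qed.

(** Three resolutions meet here: [G] carries the bound, [F] is minimal and inherits finite length
    from [G], and [F'] attains [reg]; the shifts of [F'] occur in [G]. *)
Lemma reg_le d (U : mon -> Prop) (I : S -> Prop) :
  (forall p, I p <-> supported U p) -> (exists m, U m) -> reg_bounded k d U ->
  reg I <= d.
Proof.
move=> IU [m Um] [l hl].
have UI p : supported U p <-> I p by rewrite IU.
have [G [gG /(eq_resolves UI) rG leG lG]] := finite_resolution hl.
have [|F [gF /(eq_resolves UI) rF mF]] := @minimal_free_resolution k n (supported U).
  by exists l, d.
have shiftF := minimal_shift gF rF mF gG rG.
have lF : finite_length F.
  exists l => i /ltnW li; case E: (rank F i) => [//|r].
  have [j _] := shiftF i (cast_ord (esym E) ord0).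
  by have := ltn_ord j; rewrite [X in (_ < X)%N]lG.
have [||F' [[gF' _ rF' mF'] [i [j ->]] _]] := @is_regularity_exists F I.
- by split.
- exists 'X_[m]; first by apply/IU/supportedX.
  by rewrite -msupp_eq0 msuppX.
have [l' ->] := minimal_shift gF' rF' mF' gG rG j.
by rewrite lerBlDr.
Qed.

(** The top Koszul generator has degree the sum of all degrees and sits at position [size s] for
    S/I, that is [size s - 1] for I, whence the [+ 1]. *)
Lemma reg_mgen_ge (s : seq mon) (I : S -> Prop) :
  (forall p, I p <-> supported (mgen s) p) ->
  uniq s -> pairwise_coprime s -> s != [::] ->
  (forall f, f \in s -> f != 0%MM) \/ s = [:: 0%MM] ->
  (\sum_(f <- s) mdeg f)%N%:Z - (size s)%:Z + 1 <= reg I.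
Proof.
move=> IU us cs s0 hs.
have UI p : supported (mgen s) p <-> I p by rewrite IU.
have [F [[gF lF /(eq_resolves UI) rF mF] [j jE]]] := koszul_resolution k us cs hs.
have [||F' [[gF' _ rF' mF'] _ maxF']] := @is_regularity_exists F I.
- by split.
- case: s s0 IU {us cs hs UI rF j jE} => // f s _ IU.
  exists 'X_[f]; last by rewrite -msupp_eq0 msuppX.
  by apply/IU/supportedX; exists f; rewrite ?mem_head ?lepm_refl.
have shiftF := minimal_shift gF rF mF gF' rF'.
have : (0 < size s)%N by rewrite lt0n size_eq0.
move: j jE; rewrite /cshift /crank; case: (size s) => [//|i] /= j jE _.
have [l lE] := shiftF i j; have := maxF' i l.
by rewrite -lE jE; apply: le_trans; lia.
Qed.

End Regularity.

(** * From ideals of S to sets of exponents *)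

Section MonomialIdeals.

Variables (k : fieldType) (n : nat).
Local Notation S := {mpoly k[n]}.
Local Notation mon := 'X_{1..n}.
Implicit Types (I J : S -> Prop) (f : seq mon).

Lemma monomial_spanE (M : mon -> Prop) (p : S) :
  monomial_span M p <-> supported (fun m => exists2 g, M g & (g <= m)%MM) p.
Proof.
split=> [[l [a [g [hg ->]]]]|hp].
  apply: (big_ind (supported _)) => [|p1 p2|i _].
  - exact: supported0.
  - exact: supportedD.
  have [m Mm ->] := hg i => m' /msuppM_le /allpairsP [[x y] /= [_ yX ->]].
  by move: yX; rewrite msuppX inE => /eqP ->; exists m => //; exact: lem_addl.
have /fin_all_exists2 [G hG leG] (i : 'I_(size (msupp p))) :
    exists2 g, M g & (g <= tnth (in_tuple (msupp p)) i)%MM.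
  by apply: hp; exact: mem_tnth.
pose m := tnth (in_tuple (msupp p)).
exists (size (msupp p)), (fun i => p@_(m i) *: 'X_[m i - G i]), (fun i => 'X_[G i]).
split=> [i|]; first by exists (G i).
rewrite {1}[p]mpolyE big_tnth; apply: eq_bigr => i _.
by rewrite -scalerAl -mpolyXD submK.
Qed.

Definition antichain f := {in f &, forall m m', (m <= m')%MM -> m = m'}.

Lemma monomial_generatorsP f I :
  monomial_generators f I ->
  [/\ uniq f, antichain f & forall p, I p <-> supported (mgen f) p].
Proof.
move=> [uf gf minf].
have If p : I p <-> supported (mgen f) p by rewrite gf; exact: monomial_spanE.
split=> // m m' mf m'f le_m; apply/eqP/negPn/negP => ne.
have /(_ m' m'f) : {subset f <= filter (predC1 m') f}.
  apply: minf => [x|p]; first by rewrite mem_filter => /andP [].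
  rewrite If; split=> [hp|/monomial_spanE hp]; last first.
    by apply: supported_sub hp => x [g]; rewrite mem_filter => /andP [_]; exists g.
  apply/monomial_spanE; apply: supported_sub hp => x [g gf' le_g].
  have [gE|gne] := eqVneq g m'; last by exists g; rewrite // mem_filter /= gne.
  exists m; first by rewrite mem_filter /= ne.
  by apply: lepm_trans le_m _; rewrite -gE.
by rewrite mem_filter /= eqxx.
Qed.

Lemma antichain_generators f f' I :
  antichain f -> antichain f' ->
  (forall p, I p <-> supported (mgen f) p) ->
  (forall p, I p <-> supported (mgen f') p) -> {subset f <= f'}.
Proof.
move=> af af' If If' m mf.
have toS s : m \in s -> supported (mgen s) ('X_[m] : S).
  by move=> ms; apply/supportedX; exists m; rewrite ?lepm_refl.
have /supportedX [g gf' gm] : supported (mgen f') ('X_[m] : S).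
  by rewrite -If' If; exact: toS.
have /supportedX [g' g'f g'g] : supported (mgen f) ('X_[g] : S).
  by rewrite -If If'; apply/supportedX; exists g; rewrite ?lepm_refl.
have g'm : g' = m by apply: af => //; exact: lepm_trans g'g gm.
suff -> : m = g by [].
by apply/mnmP => i; apply/eqP; rewrite eqn_leq -{1}g'm (mnm_lepP g'g) (mnm_lepP gm).
Qed.

(** If m' precedes m, then X^m X^(m' - m), with truncated difference, is a multiple of X^m'.
    Regularity puts X^(m' - m) in the ideal of the earlier generators; the one dividing it also
    divides m', hence is m', and m' <= m' - m is coprimality. *)
Lemma regular_sequence_coprime f :
  antichain f -> regular_sequence [seq ('X_[m] : S) | m <- f] ->
  pairwise_coprime f.
Proof.
move=> af rf m m' mf m'f.
wlog lt_mm' : m m' mf m'f / (index m' f < index m f)%N.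
  move=> H ne v; have [/H|/H|E] := ltngtP (index m' f) (index m f).
  - exact.
  - by move=> /(_ m'f mf); rewrite eq_sym => /(_ ne v) [] ->; [right | left].
  - by case/eqP: ne; apply: esym; rewrite -[m']/(id m') -(nth_index m m'f) E nth_index.
move=> _ v; set s := take (index m f) f.
have spanE p : ideal_span (fun q => q \in take (index m f) [seq 'X_[m] | m <- f]) p
    <-> supported (mgen s) (p : S).
  rewrite -map_take -/s -[supported _ _]monomial_spanE.
  split=> [] [l [a [g [hg ->]]]]; exists l, a, g; split=> // i.
    by have /mapP [x xs ->] := hg i; exists x.
  by have [x xs ->] := hg i; apply: map_f.
have lt_m : (index m f < size [seq ('X_[m] : S) | m <- f])%N.
  by rewrite size_map index_mem.
have := rf _ lt_m 'X_[m' - m]; rewrite !spanE (nth_map m) ?index_mem // nth_index //.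
rewrite -mpolyXD !supportedX => /(_ _) [].
  exists m'; last by apply/mnm_lepP => i; rewrite mnmDE mnmBE; lia.
  by rewrite in_take.
move=> g gs le_g.
have gm' : g = m'.
  apply: af => //; first exact: mem_take gs.
  exact: lepm_trans le_g (lem_subr _ _).
by have := mnm_lepP le_g v; rewrite gm' mnmBE; lia.
Qed.

(** The regular sequence comes with its own list [f']; uniqueness of minimal generators carries
    coprimality over to [f]. The unit ideal is singled out, its only minimal generator being 1. *)
Lemma monomial_complete_intersectionP I f :
  monomial_complete_intersection I -> monomial_generators f I ->
  [/\ uniq f, pairwise_coprime f, f != [::],
      (forall m, m \in f -> m != 0%MM) \/ f = [:: 0%MM]
    & forall p, I p <-> supported (mgen f) p].
Proof.
move=> [_ [p Ip p0] [f' /monomial_generatorsP [_ af' If'] rf']].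
move=> /monomial_generatorsP [uf af If]; split=> //.
- move=> m m' mf m'f; apply: (regular_sequence_coprime af' rf');
  exact: (antichain_generators af af' If If').
- apply: contraNneq p0 => f0; move: Ip; rewrite If f0 => hp.
  rewrite -msupp_eq0; case E: (msupp p) => [//|m s].
  by have [] := hp m; rewrite ?E ?mem_head.
have [f0|f0] := boolP (0%MM \in f); last first.
  by left=> m mf; apply: contraNneq f0 => <-.
right; have all0 m : m \in f -> m = 0%MM.
  by move=> mf; rewrite [RHS](af 0%MM m) //; apply/mnm_lepP => i; rewrite mnmE.
case: f uf f0 all0 {af If} => [//|m [|m' s]] uf _ all0.
  by rewrite (all0 m) ?mem_head.
have m0 : m = 0%MM by rewrite (all0 m) ?mem_head.
have m'0 : m' = 0%MM by rewrite (all0 m') // !inE eqxx orbT.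
by rewrite m0 m'0 /= mem_head in uf.
Qed.

Lemma colon_supported I f (Q : S -> Prop) :
  (forall p, I p <-> supported (mgen f) p) -> monomial_ideal Q ->
  forall s, colon I Q s <-> supported (mcolon f (fun q => Q 'X_[q])) s.
Proof.
move=> If [M QM] s; split=> [hs m ms q Qq|hs q Qq].
  by have /If /(_ _ (mem_msuppMX q ms)) := hs _ Qq.
apply/If => m /msuppM_le /allpairsP [[x y] /= [xs yq ->]].
apply: hs => //; apply/QM/monomial_spanE/supportedX.
by move/QM/monomial_spanE: Qq; apply.
Qed.

Lemma ideal_sum_supported r (I : 'I_r -> S -> Prop) (W : 'I_r -> mon -> Prop) :
  (forall i p, I i p <-> supported (W i) p) ->
  forall p, ideal_sum I p <-> supported (fun m => exists i, W i m) p.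
Proof.
move=> IW p; split=> [[a ha ->]|hp].
  apply: (big_ind (supported _)) => [|p1 p2|i _].
  - exact: supported0.
  - exact: supportedD.
  - by have /IW := ha i; apply: supported_sub => m Wm; exists i.
(* Each monomial of [p] is assigned to a single summand containing it. *)
pose c m := [pick i | decide (W i m)].
exists (fun i => mrestrict (fun m => c m == Some i) p).
  move=> i; apply/IW; apply: supported_mrestrict => m _.
  by rewrite /c; case: pickP => // j /decideP Wj /eqP [<-].
apply/mpolyP => m; rewrite raddf_sum /=.
under eq_bigr do rewrite mcoeff_mrestrict.
have [mp|mNp] := boolP (m \in msupp p); last first.
  by rewrite (memN_msupp_eq0 mNp) big1 // => i _; rewrite if_same.
have [i ci] : exists i, c m = Some i.
  rewrite /c; case: pickP => [i _|W0]; first by exists i.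
  by have [i /decideP] := hp m mp; rewrite W0.
rewrite (bigD1 i) //= ci eqxx big1 ?addr0 // => j ji.
by case: eqP => // -[ij]; rewrite ij eqxx in ji.
Qed.

Lemma ideal_scale_supported I (W : mon -> Prop) (m : mon) :
  (forall p, I p <-> supported W p) ->
  forall p, ideal_scale 'X_[m] I p <-> supported (mscale m W) p.
Proof.
move=> IW p; rewrite supported_mscale.
by split=> [] [q /IW Wq ->]; exists q; rewrite // mulrC.
Qed.

End MonomialIdeals.

Theorem theorem3p1 (k : fieldType) (n r : nat) (I J : {mpoly k[n]} -> Prop)
    (f : r.-tuple 'X_{1..n}) (Q : 'I_r -> {mpoly k[n]} -> Prop) :
  monomial_complete_intersection I ->
  monomial_complete_intersection J ->
  monomial_generators f I ->
  (forall i, monomial_ideal (Q i)) ->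
  reg (ideal_sum (fun i => ideal_scale 'X_[tnth f i] (colon J (Q i))))
    <= reg I + reg J.
Proof.
move=> ciI ciJ genI monQ.
have [uf cf f_n0 hf If] := monomial_complete_intersectionP ciI genI.
have [_ _ [g genJ _]] := ciJ.
have [ug cg g_n0 hg Jg] := monomial_complete_intersectionP ciJ genJ.
have regI := reg_mgen_ge If uf cf f_n0 hf.
have regJ := reg_mgen_ge Jg ug cg g_n0 hg.
(* The family [Q] reindexed by generators, which are distinct. *)
pose P (m q : 'X_{1..n}) := exists2 i, tnth f i = m & Q i 'X_[q].
have PE i q : P (tnth f i) q <-> Q i 'X_[q].
  split=> [[j /(tuple_uniqP _ uf) <-]|Qq] //; by exists i.
have LE p : ideal_sum (fun i => ideal_scale 'X_[tnth f i] (colon J (Q i))) p <->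
    supported (mcolon_sum f g P) p.
  rewrite (ideal_sum_supported (fun i =>
    ideal_scale_supported _ (colon_supported Jg (monQ i)))).
  split; apply: supported_sub => m.
    move=> [i [le_i hi]]; exists (tnth f i); first exact: mem_tnth.
    by split=> // q /PE /hi.
  move=> [_ /tnthP [i ->] [le_i hi]]; exists i; split=> // q Qq.
  by apply: hi; apply/PE.
have excE s : (forall m : 'X_{1..n}, m \in s -> m != 0%MM) ->
    (excess s)%:Z = (\sum_(m <- s) mdeg m)%N%:Z - (size s)%:Z.
  elim: s => [|m s IHs] s0; first by rewrite /excess !big_nil.
  have m0 : (0 < mdeg m)%N by rewrite lt0n mdeg_eq0 s0 ?mem_head.
  rewrite /excess !big_cons PoszD -/(excess s) IHs; last first.
    by move=> x xs; apply: s0; rewrite inE xs orbT.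
  by rewrite /=; lia.
set D := (\sum_(m <- g) mdeg m)%N%:Z - (size g)%:Z + 1.
have resJ R : reg_bounded k D (mcolon g R).
  (* If J is the unit ideal, then [D] is 0 - 1 + 1 = 0 and each colon ideal is S. *)
  case: hg => [g0|gE].
    by have := reg_bounded_mcolon k R ug cg g0; apply: reg_bounded_le; rewrite excE // addrC.
  apply: reg_bounded_full => [|m q _]; first by rewrite /D gE big_seq1 mdeg0.
  by exists 0%MM; rewrite ?gE ?mem_head //; apply/mnm_lepP => i; rewrite mnmE.
apply: (reg_le LE).
  have [m mf] : exists m, m \in tval f.
    by case: (tval f) f_n0 => // m s _; exists m; rewrite mem_head.
  have [x xg] : exists x, x \in g.
    by case: (g) g_n0 => // x s _; exists x; rewrite mem_head.
  exists (m + x)%MM, m => //; split; first exact: lem_addr.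
  move=> q _; exists x => //; apply/mnm_lepP => i.
  by rewrite !(mnmDE, mnmBE); lia.
(* Only the lower bounds for reg I and reg J enter: it suffices to bound the left side by their
   sum. *)
apply: reg_bounded_le (lerD regI regJ) _; rewrite -/D.
case: hf => [f0|fE].
  by have := reg_bounded_mcolon_sum P resJ uf cf f0; apply: reg_bounded_le; rewrite excE //; lra.
(* If I is the unit ideal, its bound is 0 and the sum is a single colon ideal of J. *)
rewrite fE big_seq1 mdeg0 /= addrA subrr add0r.
apply: eq_reg_bounded (resJ (P 0%MM)) => m; split=> [hm|].
  exists 0%MM; first by rewrite mem_head.
  by split; [apply/mnm_lepP => i; rewrite mnmE | rewrite subm0].
by move=> [m']; rewrite inE => /eqP -> [_]; rewrite subm0.
Qed.
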